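(* If $\Pi=(\mathsf P^\Pi,\mathsf V^\Pi)$ is a special quantum honest-verifier zero-knowledge (special qHVZK) $\Sigma$-protocol for a language $L$, then $\mathsf{RR}[\Pi]$ is quantum zero-knowledge. The type of zero-knowledge (computational or statistical) is preserved by $\mathsf{RR}$.
   Context: $\lambda$ is the security parameter. Notation: for bits $x,\theta$, $|x\rangle_\theta = H^\theta|x\rangle$ with $H$ the Hadamard matrix (bases $0=+$, $1=\times$), extended bitwise. $\Sigma$-protocol for $L$: a three-message interactive proof with classical messages in which the prover, on input $x$ and a classical witness, sends a first message; the verifier sends a uniformly random challenge $c\in\{0,1\}^m$; the prover sends a response; and the verifier accepts or rejects according to a predicate of $x$ and the transcript. The definitions below are given for $k$-round proofs, in which the prover's messages $a_1,\dots,a_{k+1}$ and the verifier's challenges $c_1,\dots,c_k$ are exchanged in the order $a_1,c_1,a_2,\dots,c_k,a_{k+1}$, and $\mathsf P_i^\Pi$ is the prover's next-message function producing $a_i$; a $\Sigma$-protocol is the case $k=1$. Special qHVZK (computational, resp. statistical): for any given challenges $(c_1,\dots,c_k)$ there is an efficient simulator $\mathcal S(x,c_1,\dots,c_k)$ such that for every quantum polynomial-time (resp. unbounded) distinguisher $\mathcal D$, which can query its oracle on classical values $(c_1,\dots,c_k)$, $|\Pr[\mathcal D^{\mathcal S(x,\cdot)}(1^\lambda)=1]-\Pr[\mathcal D^{\mathcal T(x,\cdot)}(1^\lambda)=1]|\le\mathrm{negl}(\lambda)$, where $x\in L$ and $\mathcal T(x,c_1,\dots,c_k)$ returns the transcript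 of the real protocol when the challenges are fixed to $c_1,\dots,c_k$. DFSS commitment to a bit $b$: the receiver sends $|y\rangle_\theta$ for random $y,\theta\in\{0,1\}^n$; the committer measures all qubits in basis $b$, obtaining $z$ (nothing is sent back); to open, it sends $b$ and $z$, and the receiver checks $z_i=y_i$ whenever $\theta_i=b$. Strings are committed bit by bit. Protocol $\mathsf{RR}[\Pi]$. Verifier message: for $i\in[k]$, the verifier runs the commit phase of the DFSS string commitment to get a quantum register $P_i$, and picks $c_i$ at random from $\{0,1\}^m$ and stores it in register $C_i$; it sends $P_1C_1\cdots P_kC_k$. (A memory bound on the prover applies after the transmission of each $P_i$; it restricts only malicious provers.) Prover: compute $a_1=\mathsf P_1^\Pi(x)$; for $i\in[k]$, commit to $a_i$ by measuring $P_i$; measure $C_i$ in the computational basis to get $c_i$; compute $a_{i+1}=\mathsf P_{i+1}^\Pi(a_1,\dots,a_i,c_1,\dots,c_i,x)$. Prover message: all $a_i$ and the opening strings of the commitments. The verifier accepts iff every opening is valid and the transcript $(a_1,\dots,a_{k+1},c_1,\dots,c_k)$ is accepting for $\Pi$ on $x$. Quantum zero-knowledge: a proof system is computationally quantum zero-knowledge if for every polynomial-time quantum verifier $\mathsf V^*$ receiving $x\in L$ and a polynomial-size quantum auxiliary register $E$ there is a polynomial-time quantum simulator receiving the same inputs such that the quantum channels (acting on $E$) given by the interaction of the honest prover with $\mathsf V^*(x,\cdot)$ and by the simulator are computationally indistinguishable (for polynomial-size distinguishers, with inputs possibly entangled with a reference system); it is statistically quantum zero-knowledge if $\mathsf V^*$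 is unbounded and the channels are statistically indistinguishable. The verifier's quantum memory is not bounded.
   Formalization: Computational special qHVZK is assumed against non-uniform polynomial-size distinguishers with quantum advice, and in the statistical case the polynomial-time simulator has black-box access to the unbounded verifier V*'s operations. *)

(* Defs.v *)
From HB Require Import structures.
From mathcomp Require Import all_boot all_order all_algebra.
From mathcomp Require Import reals.
From mathcomp Require Import complex.

Set Implicit Arguments.
Unset Strict Implicit.
Unset Printing Implicit Defensive.

Import Order.TTheory GRing.Theory Num.Theory.
Local Open Scope ring_scope.
Local Open Scope complex_scope.

(* Classical polynomial time is defined with Jones's WHILE language over binary
   trees, in point-free form: a program denotes a partial function on trees, and
   the cost of a run is the number of instructions executed.  With this unit cost the language computes exactly
   the polynomial-time functions, provided that the size of the output is
   charged as well (pairing shares subtrees). *)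

Inductive tree := Leaf | Node of tree & tree.

Fixpoint tsize (t : tree) : nat :=
  if t is Node a b then (tsize a + tsize b).+1 else 1%N.

Definition thead (t : tree) := if t is Node a _ then a else Leaf.
Definition ttail (t : tree) := if t is Node _ b then b else Leaf.

Inductive prog :=
  | PId | PLeaf | PHead | PTail
  | PPair of prog & prog
  | PComp of prog & prog            (* [PComp p q]: first [p], then [q] *)
  | PIf of prog & prog & prog
  | PWhile of prog & prog.

Inductive eval : prog -> tree -> tree -> nat -> Prop :=
  | EId t : eval PId t t 1
  | ELeaf t : eval PLeaf t Leaf 1
  | EHead t : eval PHead t (thead t) 1
  | ETail t : eval PTail t (ttail t) 1
  | EPair p q t a b i j :
      eval p t a i -> eval q t b j -> eval (PPair p q) t (Node a b) (i + j).+1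
  | EComp p q t a b i j :
      eval p t a i -> eval q a b j -> eval (PComp p q) t b (i + j).+1
  | EIfT c p q t a b s i j :
      eval c t (Node a b) i -> eval p t s j -> eval (PIf c p q) t s (i + j).+1
  | EIfF c p q t s i j :
      eval c t Leaf i -> eval q t s j -> eval (PIf c p q) t s (i + j).+1
  | EWhileStop c p t i :
      eval c t Leaf i -> eval (PWhile c p) t t i.+1
  | EWhileStep c p t a b s u i j k :
      eval c t (Node a b) i -> eval p t s j -> eval (PWhile c p) s u k ->
      eval (PWhile c p) t u (i + j + k).+1.

Definition polybound (d n : nat) : nat := (n ^ d + d)%N.

(* The instance [i], presented to the program as [inp i], has size [sz i]. *)
Definition polytime (I : Type) (inp : I -> tree) (sz : I -> nat)
    (f : I -> tree) : Prop :=
  exists (p : prog) (d : nat), forall i, exists t : nat,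
    eval p (inp i) (f i) t /\ (t + tsize (f i) <= polybound d (sz i))%N.

Definition bits := seq bool.

Fixpoint enc_nat (n : nat) : tree := if n is k.+1 then Node Leaf (enc_nat k) else Leaf.
Definition enc_bool (b : bool) : tree := if b then Node Leaf Leaf else Leaf.
Fixpoint enc_bits (s : bits) : tree :=
  if s is b :: s' then Node (enc_bool b) (enc_bits s') else Leaf.

(* Numbers are in unary. *)
Definition polytime_length (l : nat -> nat) : Prop :=
  polytime enc_nat (fun n => n) (fun n => enc_nat (l n)).

(* A basis state of an m-qubit register is a bit list of length m.  An operator
   [rho] is given by its entries [rho x x'], and a superoperator [Phi] by
   [K y y' x x'], the entry (y, y') of Phi(|x><x'|).  Only lists of the right
   lengths matter: all sums below range over tuples. *)

Definition sop (R : realType) := bits -> bits -> bits -> bits -> R[i].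

Definition unitary_sop (R : realType) (U : bits -> bits -> R[i]) : sop R :=
  fun y y' x x' => U y x * (U y' x')^*.

(* [K1] followed by [K2], through an [m]-qubit register. *)
Definition seq_sop (R : realType) (m : nat) (K1 K2 : sop R) : sop R :=
  fun y y' x x' =>
    \sum_(u : m.-tuple bool) \sum_(u' : m.-tuple bool) K2 y y' u u' * K1 u u' x x'.

(* [K1], from [m] to [n] qubits, on the first wires and [K2] on the others. *)
Definition par_sop (R : realType) (m n : nat) (K1 K2 : sop R) : sop R :=
  fun y y' x x' =>
    K1 (take n y) (take n y') (take m x) (take m x') *
    K2 (drop n y) (drop n y') (drop m x) (drop m x').

Definition id_sop (R : realType) : sop R :=
  unitary_sop (fun y x => (y == x)%:R).

Definition channel (R : realType) (m n : nat) (K : sop R) : Prop :=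
  exists (N : nat) (A : 'I_N -> bits -> bits -> R[i]),
    (forall x x' : m.-tuple bool,
       \sum_(i < N) \sum_(y : n.-tuple bool) (A i y x)^* * A i y x' = (x == x')%:R) /\
    (forall (y y' : n.-tuple bool) (x x' : m.-tuple bool),
       K y y' x x' = \sum_(i < N) A i y x * (A i y' x')^*).

Definition density (R : realType) (m : nat) (rho : bits -> bits -> R[i]) : Prop :=
  (forall v : bits -> R[i],
     0 <= \sum_(x : m.-tuple bool) \sum_(x' : m.-tuple bool)
            (v x)^* * rho x x' * v x') /\
  \sum_(x : m.-tuple bool) rho x x = 1.

(* Probability that the one-qubit output of [K] on the [m]-qubit state [rho] is 1. *)
Definition Pr1 (R : realType) (m : nat) (K : sop R) (rho : bits -> bits -> R[i]) : R :=
  complex.Re (\sum_(x : m.-tuple bool) \sum_(x' : m.-tuple bool)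
                K [:: true] [:: true] x x' * rho x x').

(* The entry <z| H^theta |y> of the bitwise power of the Hadamard matrix. *)
Definition hadamard (R : realType) (theta z y : bits) : R[i] :=
  \prod_(i < size theta)
    let a := nth false z i in let b := nth false y i in
    if nth false theta i then ((Num.sqrt 2)^-1)%:C * (-1) ^+ (a && b)
    else (a == b)%:R.

(* [Wires n] is the identity on n wires, [Swap m n] exchanges a block of m wires
   with the following block of n wires, and [Box i m n] is a call to the i-th
   black box, which has m input and n output wires. *)
Inductive circ :=
  | Wires of nat
  | Swap of nat & nat
  | GateH | GateT | GateCNOT
  | Init | Measure | Discard
  | Box of nat & nat & nat
  | Seq of circ & circ
  | Par of circ & circ.

Fixpoint cin (c : circ) : nat :=
  match c with
  | Wires n => n
  | Swap m n => m + n
  | GateH | GateT | Measure | Discard => 1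
  | GateCNOT => 2
  | Init => 0
  | Box _ m _ => m
  | Seq c1 _ => cin c1
  | Par c1 c2 => cin c1 + cin c2
  end.

Fixpoint cout (c : circ) : nat :=
  match c with
  | Wires n => n
  | Swap m n => m + n
  | GateH | GateT | Measure | Init => 1
  | GateCNOT => 2
  | Discard => 0
  | Box _ _ n => n
  | Seq _ c2 => cout c2
  | Par c1 c2 => cout c1 + cout c2
  end.

(* [sig i] gives the numbers of input and output wires of the black box [i], if
   that box is available. *)
Definition signature := nat -> option (nat * nat).

Definition no_box : signature := fun _ => None.
Definition one_box (m n : nat) : signature :=
  fun i => if i is 0 then Some (m, n) else None.
Definition two_boxes (m0 n0 m1 n1 : nat) : signature :=
  fun i => match i with 0 => Some (m0, n0) | 1 => Some (m1, n1) | _ => None end.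

Fixpoint wf (sig : signature) (c : circ) : bool :=
  match c with
  | Box i m n => sig i == Some (m, n)
  | Seq c1 c2 => [&& wf sig c1, wf sig c2 & cout c1 == cin c2]
  | Par c1 c2 => wf sig c1 && wf sig c2
  | _ => true
  end.

Definition circuit (sig : signature) (m n : nat) (c : circ) : Prop :=
  [/\ wf sig c, cin c = m & cout c = n].

Fixpoint calls (i : nat) (c : circ) : nat :=
  match c with
  | Box j _ _ => (i == j)
  | Seq c1 c2 | Par c1 c2 => calls i c1 + calls i c2
  | _ => 0
  end.

Fixpoint sem (R : realType) (env : nat -> sop R) (c : circ) : sop R :=
  match c with
  | Wires _ => id_sop R
  | Swap m _ => unitary_sop (fun y x => (y == drop m x ++ take m x)%:R)
  | GateH => unitary_sop (hadamard R [:: true])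
  | GateT => unitary_sop (fun y x => (y == x)%:R *
      (if x == [:: true] then (Num.sqrt 2)^-1 +i* (Num.sqrt 2)^-1 else 1))
  | GateCNOT => unitary_sop (fun y x =>
      (y == [:: nth false x 0; nth false x 0 (+) nth false x 1])%:R)
  | Init => unitary_sop (fun y x => (y == [:: false])%:R)
  | Measure => fun y y' x x' => [&& y == y', x == x' & y == x]%:R
  | Discard => fun y y' x x' => (x == x')%:R
  | Box i _ _ => env i
  | Seq c1 c2 => seq_sop (cout c1) (sem env c1) (sem env c2)
  | Par c1 c2 => par_sop (cin c1) (cout c1) (sem env c1) (sem env c2)
  end.

Definition no_env (R : realType) : nat -> sop R := fun _ _ _ _ _ => 0.

Fixpoint enc_circ (c : circ) : tree :=
  match c with
  | Wires n => Node (enc_nat 0) (enc_nat n)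
  | Swap m n => Node (enc_nat 1) (Node (enc_nat m) (enc_nat n))
  | GateH => Node (enc_nat 2) Leaf
  | GateT => Node (enc_nat 3) Leaf
  | GateCNOT => Node (enc_nat 4) Leaf
  | Init => Node (enc_nat 5) Leaf
  | Measure => Node (enc_nat 6) Leaf
  | Discard => Node (enc_nat 7) Leaf
  | Box i m n => Node (enc_nat 8) (Node (enc_nat i) (Node (enc_nat m) (enc_nat n)))
  | Seq c1 c2 => Node (enc_nat 9) (Node (enc_circ c1) (enc_circ c2))
  | Par c1 c2 => Node (enc_nat 10) (Node (enc_circ c1) (enc_circ c2))
  end.

Definition desc (c : circ) : tree :=
  Node (enc_nat (cin c)) (Node (enc_nat (cout c)) (enc_circ c)).

(* Wires are counted, since their number is written in unary in [desc c]. *)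
Definition csize (c : circ) : nat := tsize (desc c).

(* A (uniform) polynomial-time quantum algorithm with classical input x: its
   circuit for x is generated from x in classical polynomial time. *)
Definition qpt_family (F : bits -> circ) : Prop :=
  polytime enc_bits size (fun x => desc (F x)).

(* Distinguishers are non-uniform, with quantum advice: a bound eps depending only
   on the type of the distinguisher and on the exponent d has to hold for every
   x, w, distinguisher of size at most [polybound d (size x)] and state. *)
Inductive zk_type := Computational | Statistical.

(* The security parameter is the length of the instance x. *)
Definition negligible (R : realType) (eps : nat -> R) : Prop :=
  forall d : nat, exists N : nat, forall n : nat,
    (N < n)%N -> `|eps n| <= (n%:R ^+ d)^-1.

(* [K] is a distinguisher on [m] qubits: realized by an elementary circuit of
   size at most [polybound d lam], or an arbitrary channel. *)
Definition distinguisher (R : realType) (k : zk_type) (d lam m : nat) (K : sop R) : Prop :=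
  match k with
  | Computational => exists D : circ,
      [/\ circuit no_box m 1 D, (csize D <= polybound d lam)%N & K = sem (no_env R) D]
  | Statistical => channel m 1 K
  end.

(* [F] maps an oracle, i.e. a superoperator from [i] to [o] qubits, to the
   superoperator computed by an oracle distinguisher (box 0 is the oracle) on an
   [m]-qubit advice state.  An unbounded distinguisher applies arbitrary
   channels (the other boxes) between its polynomially many oracle queries. *)
Definition oracle_distinguisher (R : realType) (k : zk_type) (d lam i o m : nat)
    (F : sop R -> sop R) : Prop :=
  match k with
  | Computational => exists D : circ,
      [/\ circuit (one_box i o) m 1 D, (csize D <= polybound d lam)%N &
          F = fun O => sem (fun j => if j is 0 then O else no_env R j) D]
  | Statistical => exists (D : circ) (sig : signature) (env : nat -> sop R),
      [/\ circuit sig m 1 D, (calls 0 D <= polybound d lam)%N,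
          sig 0 = Some (i, o),
          (forall j a b, j != 0%N -> sig j = Some (a, b) -> channel a b (env j)) &
          F = fun O => sem (fun j => if j is 0 then O else env j) D]
  end.

(* Measures the query and the answer of [K] in the computational basis. *)
Definition classical_oracle (R : realType) (K : sop R) : sop R :=
  fun y y' x x' => if (y == y') && (x == x') then K y y x x else 0.

(* [sp_P1 x w] is the distribution of the prover's first message and
   [sp_P2 x w a1 c] that of its response, conditioned on the previous messages;
   [sp_wit x w] says that w is a witness with which the honest prover may be run
   on x.  The lengths are functions of the security parameter. *)
Record sigma_protocol (R : realType) := SigmaProtocol {
  sp_wit : bits -> bits -> Prop;
  sp_l1 : nat -> nat;
  sp_m : nat -> nat;
  sp_l2 : nat -> nat;
  sp_P1 : bits -> bits -> bits -> R;
  sp_P2 : bits -> bits -> bits -> bits -> bits -> R;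
  sp_acc : bits -> bits -> bits -> bits -> bool
}.

Definition distribution (R : realType) (l : nat) (p : bits -> R) : Prop :=
  (forall a : l.-tuple bool, 0 <= p a) /\ \sum_(a : l.-tuple bool) p a = 1.

Section SigmaProtocols.
Context {R : realType}.
Implicit Types (Pi : sigma_protocol R) (x w : bits) (k : zk_type).

Definition honest_acceptance Pi x w : R :=
  \sum_(c : (sp_m Pi (size x)).-tuple bool) (2 ^+ sp_m Pi (size x))^-1 *
    \sum_(a1 : (sp_l1 Pi (size x)).-tuple bool) sp_P1 Pi x w a1 *
      \sum_(a2 : (sp_l2 Pi (size x)).-tuple bool) sp_P2 Pi x w a1 c a2 *
        (sp_acc Pi x a1 c a2)%:R.

Definition cheating_acceptance Pi x (a1 : bits) (P2 : bits -> bits) : R :=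
  \sum_(c : (sp_m Pi (size x)).-tuple bool) (2 ^+ sp_m Pi (size x))^-1 *
    (sp_acc Pi x a1 c (P2 c))%:R.

(* An interactive proof for L: polynomial-time verifier, and an inverse
   polynomial gap between completeness and soundness.  Deterministic cheating
   provers suffice, by convexity. *)
Definition sigma_protocol_for Pi (L : bits -> Prop) : Prop :=
  [/\ forall x, L x <-> exists w, sp_wit Pi x w,
      [/\ polytime_length (sp_l1 Pi), polytime_length (sp_m Pi) &
          polytime_length (sp_l2 Pi)],
      polytime
        (fun t : bits * bits * bits * bits => let: (x, a1, c, a2) := t in
           Node (enc_bits x) (Node (enc_bits a1) (Node (enc_bits c) (enc_bits a2))))
        (fun t => let: (x, a1, c, a2) := t in (size x + size a1 + size c + size a2)%N)
        (fun t => let: (x, a1, c, a2) := t in enc_bool (sp_acc Pi x a1 c a2)),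
      forall x w, sp_wit Pi x w ->
        distribution (sp_l1 Pi (size x)) (sp_P1 Pi x w) /\
        forall (a1 : (sp_l1 Pi (size x)).-tuple bool) (c : (sp_m Pi (size x)).-tuple bool),
          distribution (sp_l2 Pi (size x)) (sp_P2 Pi x w a1 c) &
      exists (compl sound : nat -> R) (d : nat),
        [/\ forall n, sound n + ((polybound d n)%:R)^-1 <= compl n,
            forall x w, sp_wit Pi x w -> compl (size x) <= honest_acceptance Pi x w &
            forall x, ~ L x ->
              forall (a1 : (sp_l1 Pi (size x)).-tuple bool)
                     (P2 : bits -> (sp_l2 Pi (size x)).-tuple bool),
                cheating_acceptance Pi x a1 P2 <= sound (size x)]].

Definition transcript_length Pi (n : nat) : nat := (sp_l1 Pi n + sp_m Pi n + sp_l2 Pi n)%N.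

(* The oracle T(x, c): a fresh transcript a1 ++ c ++ a2 of the real protocol. *)
Definition real_transcript Pi x w : sop R :=
  fun y y' c c' =>
    let l1 := sp_l1 Pi (size x) in
    let m := sp_m Pi (size x) in
    let a1 := take l1 y in
    let a2 := drop (l1 + m) y in
    if [&& y == y', c == c' & take m (drop l1 y) == c]
    then (sp_P1 Pi x w a1 * sp_P2 Pi x w a1 c a2)%:C else 0.

Definition special_qHVZK k Pi : Prop :=
  exists S : bits -> circ,
    [/\ qpt_family S,
        forall x, circuit no_box (sp_m Pi (size x)) (transcript_length Pi (size x)) (S x) &
        forall d : nat, exists2 eps : nat -> R, negligible eps &
          forall x w, sp_wit Pi x w ->
          forall (r : nat) (rho : bits -> bits -> R[i]) (D : sop R -> sop R),
            density r rho ->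
            oracle_distinguisher k d (size x)
              (sp_m Pi (size x)) (transcript_length Pi (size x)) r D ->
            `|Pr1 r (D (classical_oracle (sem (no_env R) (S x)))) rho
              - Pr1 r (D (real_transcript Pi x w)) rho| <= eps (size x)].

End SigmaProtocols.

(* The verifier sends the pure state [qp_ver_msg x r] on [qp_lv (size x)] qubits,
   for uniformly random coins r, and the prover's reply is classical. *)
Record qproof (R : realType) := QProof {
  qp_wit : bits -> bits -> Prop;
  qp_coins : nat -> nat;
  qp_lv : nat -> nat;
  qp_lr : nat -> nat;
  qp_ver_msg : bits -> bits -> bits -> R[i];
  qp_prover : bits -> bits -> sop R;
  qp_acc : bits -> bits -> bits -> bool
}.

Section ZeroKnowledge.
Context {R : realType}.
Implicit Types (Q : qproof R) (x w : bits) (k : zk_type).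

(* A malicious verifier first maps its auxiliary register E (e qubits) to its
   message and a private register (m qubits), then the reply and the private
   register to E. *)
Definition interaction Q x w (m : nat) (V1 V2 : sop R) : sop R :=
  let lv := qp_lv Q (size x) in
  let lr := qp_lr Q (size x) in
  seq_sop (lv + m) V1
    (seq_sop (lr + m) (par_sop lv lr (qp_prover Q x w) (id_sop R)) V2).

(* Two channels on E (e qubits), applied to a half of a state of E and of a
   reference register (r qubits) that is also given to the distinguisher. *)
Definition channel_advantage (e r : nat) (D Phi Psi : sop R)
    (rho : bits -> bits -> R[i]) : R :=
  let run Xi := seq_sop (e + r) (par_sop e e Xi (id_sop R)) D in
  `|Pr1 (e + r) (run Phi) rho - Pr1 (e + r) (run Psi) rho|.

Definition indistinguishable k Q (e : bits -> nat) (Real : bits -> bits -> sop R)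
    (Sim : bits -> sop R) : Prop :=
  forall d : nat, exists2 eps : nat -> R, negligible eps &
    forall x w, qp_wit Q x w ->
    forall (r : nat) (rho : bits -> bits -> R[i]) (D : sop R),
      density (e x + r) rho ->
      distinguisher k d (size x) (e x + r) D ->
      channel_advantage (e x) r D (Real x w) (Sim x) rho <= eps (size x).

Definition computational_zk Q : Prop :=
  forall (e m : bits -> nat) (V1 V2 : bits -> circ),
    qpt_family V1 -> qpt_family V2 ->
    (forall x, circuit no_box (e x) (qp_lv Q (size x) + m x) (V1 x)) ->
    (forall x, circuit no_box (qp_lr Q (size x) + m x) (e x) (V2 x)) ->
    exists S : bits -> circ,
      [/\ qpt_family S,
          forall x, circuit no_box (e x) (e x) (S x) &
          indistinguishable Computational Q e
            (fun x w => interaction Q x w (m x)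
               (sem (no_env R) (V1 x)) (sem (no_env R) (V2 x)))
            (fun x => sem (no_env R) (S x))].

(* The output of an unbounded verifier need not be computable in polynomial time:
   its simulator runs in polynomial time given black-box access to the two
   operations of the verifier (boxes 0 and 1).  The
   sizes of the registers on which these operations act are part of its input. *)
Definition statistical_zk Q : Prop :=
  forall (e m : bits -> nat) (V1 V2 : bits -> sop R),
    (exists d, forall x, (e x <= polybound d (size x))%N) ->
    (forall x, channel (e x) (qp_lv Q (size x) + m x) (V1 x)) ->
    (forall x, channel (qp_lr Q (size x) + m x) (e x) (V2 x)) ->
    exists S : bits -> circ,
      [/\ polytime
            (fun x => Node (enc_bits x) (Node (enc_nat (e x)) (enc_nat (m x))))
            (fun x => (size x + e x + m x)%N) (fun x => desc (S x)),
          forall x, circuit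
            (two_boxes (e x) (qp_lv Q (size x) + m x) (qp_lr Q (size x) + m x) (e x))
            (e x) (e x) (S x) &
          indistinguishable Statistical Q e
            (fun x w => interaction Q x w (m x) (V1 x) (V2 x))
            (fun x => sem (fun i => if i is 0 then V1 x else V2 x) (S x))].

Definition quantum_zk k Q : Prop :=
  match k with
  | Computational => computational_zk Q
  | Statistical => statistical_zk Q
  end.

End ZeroKnowledge.

Section RoundReduction.
Context {R : realType}.
Variables (Pi : sigma_protocol R) (n : nat -> nat).
(* [n] is the number of qubits used by the commitment to one bit. *)

Definition commit_bases (lam : nat) (a : bits) : bits :=
  flatten [seq nseq (n lam) b | b <- a].

Definition rr_P (lam : nat) : nat := (sp_l1 Pi lam * n lam)%N.

(* The coins are y ++ theta ++ c. *)
Definition rr_ver_msg (x coins u : bits) : R[i] :=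
  let lp := rr_P (size x) in
  let y := take lp coins in
  let theta := take lp (drop lp coins) in
  let c := drop (lp + lp) coins in
  hadamard R theta (take lp u) y * (drop lp u == c)%:R.

(* On registers P C, with reply a1 ++ a2 ++ z: a1 is drawn, P is measured in the
   bases given by the bits of a1 with outcome z, C is measured in the
   computational basis with outcome c, and a2 is drawn. *)
Definition rr_prover (x w : bits) : sop R :=
  fun reply reply' u u' =>
    let l1 := sp_l1 Pi (size x) in
    let l2 := sp_l2 Pi (size x) in
    let lp := rr_P (size x) in
    let a1 := take l1 reply in
    let a2 := take l2 (drop l1 reply) in
    let z := drop (l1 + l2) reply in
    let theta := commit_bases (size x) a1 in
    let c := drop lp u in
    if (reply == reply') && (c == drop lp u')
    then (sp_P1 Pi x w a1 * sp_P2 Pi x w a1 c a2)%:C *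
         (hadamard R theta z (take lp u) * (hadamard R theta z (take lp u'))^*)
    else 0.

Definition rr_acc (x coins reply : bits) : bool :=
  let l1 := sp_l1 Pi (size x) in
  let l2 := sp_l2 Pi (size x) in
  let lp := rr_P (size x) in
  let y := take lp coins in
  let theta := take lp (drop lp coins) in
  let c := drop (lp + lp) coins in
  let a1 := take l1 reply in
  let a2 := take l2 (drop l1 reply) in
  let z := drop (l1 + l2) reply in
  let b := commit_bases (size x) a1 in
  [forall i : 'I_lp, (nth false theta i == nth false b i) ==>
                     (nth false z i == nth false y i)]
  && sp_acc Pi x a1 c a2.

Definition RR : qproof R := {|
  qp_wit := sp_wit Pi;
  qp_coins := fun lam => (rr_P lam + rr_P lam + sp_m Pi lam)%N;
  qp_lv := fun lam => (rr_P lam + sp_m Pi lam)%N;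
  qp_lr := fun lam => (sp_l1 Pi lam + sp_l2 Pi lam + rr_P lam)%N;
  qp_ver_msg := rr_ver_msg;
  qp_prover := rr_prover;
  qp_acc := rr_acc
|}.

End RoundReduction.

(* Main.v *)
Require Import Defs.
From mathcomp Require Import all_boot all_order all_algebra.
From mathcomp Require Import reals.
From mathcomp Require Import complex zify ring lra.

(* The honest prover of RR[Pi] measures P in the bases given by a1 and C in the
   computational basis, and these measurements act on disjoint registers.  The
   simulator therefore measures C first, runs the special honest-verifier
   simulator on the outcome c, and measures P in the bases given by the a1 of
   the simulated transcript.  Replacing that simulator by a single classical
   query on c to an oracle, one and the same circuit yields the real interaction
   for the real transcript oracle and the simulated one for the oracle of the
   honest-verifier simulator, so a distinguisher between the two channels is an
   oracle distinguisher against special qHVZK.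

   A measurement in a basis chosen by a qubit is implemented exactly with H, T
   and CNOT: (H T^7) X^a (T H T^2) = S H^a, and the phase S does not affect the
   outcome.  That the circuits can be generated in polynomial time rests on a
   bounded-loop combinator for the WHILE language. *)

Set Implicit Arguments.
Unset Strict Implicit.
Unset Printing Implicit Defensive.

Local Notation tsize := Defs.tsize.
Local Notation thead := Defs.thead.
Local Notation ttail := Defs.ttail.

(** * Polynomial bounds and polynomial time *)

(** A malicious verifier is no harder than the honest one because its whole message, challenge
    included, arrives before the prover reveals anything: c is known before a1 has to be produced,
    so nothing is rewound. C may be in superposition and entangled with the verifier's memory, but
    the honest prover measures it, which is why a query on classical values suffices. The response
    depends on a1 and c but not on the outcome z, so the oracle call and the measurement of P
    commute apart from the flow of a1.

    Because the basis-controlled measurement is exact, the reduction is an equality of advantages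
    ([hybrid_advantage]) and not an approximation. Both types of zero-knowledge are instances of it:
    the verifier and the distinguisher are written out as circuits in the computational case and
    kept as boxes in the statistical one. *)

Definition poly_bounded (I : Type) (sz f : I -> nat) : Prop :=
  exists d, forall i, f i <= polybound d (sz i).

(** Since d < n ^ d and n is at least 2, one more factor n absorbs the additive d. Powers do not
    grow for n at most 1, so the bounds below treat these sizes apart, by constants. *)
Lemma polybound_le_exp d n : 1 < n -> polybound d n <= n ^ d.+1.
Proof.
move=> n1; rewrite /polybound expnS; have := ltn_expl d n1.
by move: (n ^ d) => e; nia.
Qed.

Lemma polybound_small d n : n <= 1 -> polybound d n <= d.+1.
Proof.
by case: n => [|[|//]] _; rewrite /polybound ?exp1n ?add1n //;
  case: d => [|d]; rewrite ?expn0 ?exp0n //; lia.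
Qed.

Lemma polybound_ge_exp k C n : 1 < n -> n ^ k <= polybound (k + C) n.
Proof.
move=> n1; rewrite /polybound expnD; apply: leq_trans (leq_addr _ _).
by rewrite leq_pmulr // expn_gt0; case: n n1.
Qed.

Lemma polybound_mono d m n : m <= n -> polybound d m <= polybound d n.
Proof.
move=> mn; rewrite /polybound leq_add2r.
by case: d => [|d]; rewrite ?expn0 // leq_exp2r.
Qed.

Section PolyBounded.
Variables (I : Type) (sz : I -> nat).
Implicit Types f g : I -> nat.

(** The single exponent k + C serves both regimes: it exceeds the power k for sizes above 1, and its
    additive part covers the constant C for the others. *)
Lemma poly_boundedI f k C :
  (forall i, 1 < sz i -> f i <= sz i ^ k) ->
  (forall i, sz i <= 1 -> f i <= C) -> poly_bounded sz f.
Proof.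
move=> big small; exists (k + C) => i; have [n1|n1] := ltnP 1 (sz i).
  by apply: leq_trans (big i n1) _; apply: polybound_ge_exp.
by apply: leq_trans (small i n1) _; rewrite /polybound; lia.
Qed.

Lemma poly_bounded_leq f g :
  (forall i, f i <= g i) -> poly_bounded sz g -> poly_bounded sz f.
Proof. by move=> fg [d gd]; exists d => i; apply: leq_trans (fg i) (gd i). Qed.

Lemma poly_bounded_const C : poly_bounded sz (fun=> C).
Proof. by exists C => i; rewrite /polybound leq_addl. Qed.

Lemma poly_bounded_sz : poly_bounded sz sz.
Proof. by exists 1 => i; rewrite /polybound expn1 leq_addr. Qed.

Lemma poly_boundedM f g :
  poly_bounded sz f -> poly_bounded sz g -> poly_bounded sz (fun i => f i * g i).
Proof.
move=> [a fa] [b gb].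
apply: (@poly_boundedI _ (a.+1 + b.+1) (a.+1 * b.+1)) => i n1.
  rewrite expnD leq_mul //.
    exact: leq_trans (fa i) (polybound_le_exp _ n1).
  exact: leq_trans (gb i) (polybound_le_exp _ n1).
rewrite leq_mul //.
  exact: leq_trans (fa i) (polybound_small _ n1).
exact: leq_trans (gb i) (polybound_small _ n1).
Qed.

Lemma poly_boundedD f g :
  poly_bounded sz f -> poly_bounded sz g -> poly_bounded sz (fun i => f i + g i).
Proof.
move=> [a fa] [b gb].
apply: (@poly_boundedI _ (a.+1 + b.+1) (a.+1 + b.+1)) => i n1.
  have A2 : 1 < sz i ^ a.+1 by apply: leq_ltn_trans (ltn_expl a.+1 n1).
  have B2 : 1 < sz i ^ b.+1 by apply: leq_ltn_trans (ltn_expl b.+1 n1).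
  apply: (@leq_trans (sz i ^ a.+1 + sz i ^ b.+1)).
    rewrite leq_add //.
      exact: leq_trans (fa i) (polybound_le_exp _ n1).
    exact: leq_trans (gb i) (polybound_le_exp _ n1).
  rewrite expnD; have := leq_mul (leqnn (sz i ^ a.+1)) B2.
  by have := leq_mul A2 (leqnn (sz i ^ b.+1)); lia.
rewrite leq_add //.
  exact: leq_trans (fa i) (polybound_small _ n1).
exact: leq_trans (gb i) (polybound_small _ n1).
Qed.

Lemma poly_boundedS f : poly_bounded sz f -> poly_bounded sz (fun i => (f i).+1).
Proof.
move=> fb; have := poly_boundedD fb (poly_bounded_const 1).
by apply: poly_bounded_leq => i; rewrite addn1.
Qed.

Lemma poly_bounded_polybound d f :
  poly_bounded sz f -> poly_bounded sz (fun i => polybound d (f i)).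
Proof.
move=> [b fb].
apply: (@poly_boundedI _ (b.+1 * d.+1) (polybound d b.+1)) => i n1.
  apply: leq_trans (polybound_mono d (leq_trans (fb i) (polybound_le_exp _ n1))) _.
  rewrite expnM; apply: polybound_le_exp.
  apply: (leq_trans n1); rewrite expnS leq_pmulr // expn_gt0; lia.
exact: polybound_mono (leq_trans (fb i) (polybound_small _ n1)).
Qed.

Lemma poly_bounded_comp (J : Type) (szJ : J -> nat) (h : I -> J) (f : J -> nat) :
  poly_bounded szJ f -> poly_bounded sz (szJ \o h) -> poly_bounded sz (f \o h).
Proof.
move=> [d fd] hb; apply: poly_bounded_leq (poly_bounded_polybound d hb) => i.
exact: fd.
Qed.

End PolyBounded.

Fixpoint spine (t : tree) : nat := if t is Node _ b then (spine b).+1 else 0.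

Lemma spine_tsize t : spine t <= tsize t.
Proof. by elim: t => //= a _ b IH; lia. Qed.

Lemma spine_enc_nat n : spine (enc_nat n) = n.
Proof. by elim: n => //= n ->. Qed.

Lemma spine_enc_bits s : spine (enc_bits s) = size s.
Proof. by elim: s => //= b s ->. Qed.

Lemma tsize_enc_nat n : tsize (enc_nat n) = (n.*2).+1.
Proof. by elim: n => //= n ->; lia. Qed.

Lemma tsize_enc_bits s : tsize (enc_bits s) <= (size s).*2.*2.+1.
Proof. by elim: s => //= -[] s IH /=; lia. Qed.

Section PolytimeP.
Variables (I : Type) (inp : I -> tree) (sz : I -> nat).
Implicit Types f g : I -> tree.
Local Notation PT := (polytime inp sz).

(** Time and output size get separate, unspecified polynomial bounds in place of one joint
    [polybound], so that closure proofs can combine bounds without computing exponents. *)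
Lemma polytimeP f :
  PT f <-> exists2 p, poly_bounded sz (tsize \o f) &
    exists2 t : I -> nat, poly_bounded sz t &
      forall i, exists2 s, s <= t i & eval p (inp i) (f i) s.
Proof.
split=> [[p [d pd]]|[p fb [t tb pt]]].
  exists p; first by exists d => i /=; have [s [_]] := pd i; lia.
  exists (fun i => polybound d (sz i)); first by exists d.
  by move=> i; have [s [es le]] := pd i; exists s => //; lia.
have [d hd] := poly_boundedD tb fb; exists p, d => i.
have [s st es] := pt i; exists s; split=> //.
by apply: leq_trans (hd i) => /=; lia.
Qed.

End PolytimeP.

Section Polytime.
Variables (I : Type) (inp : I -> tree) (sz : I -> nat).
Implicit Types f g : I -> tree.
Local Notation PT := (polytime inp sz).

Lemma polytime_bounded f : PT f -> poly_bounded sz (tsize \o f).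
Proof. by case/polytimeP. Qed.

Lemma polytime_ext f g : f =1 g -> PT f -> PT g.
Proof. by move=> fg [p [d pd]]; exists p, d => i; rewrite -fg. Qed.

Lemma polytime_leaf : PT (fun=> Leaf).
Proof.
apply/polytimeP; exists PLeaf; first exact: poly_bounded_const.
by exists (fun=> 1); [exact: poly_bounded_const | move=> i; exists 1 => //; constructor].
Qed.

Lemma polytime_id : poly_bounded sz (tsize \o inp) -> PT inp.
Proof.
move=> b; apply/polytimeP; exists PId => //.
by exists (fun=> 1); [exact: poly_bounded_const | move=> i; exists 1 => //; constructor].
Qed.

Lemma polytime_node f g : PT f -> PT g -> PT (fun i => Node (f i) (g i)).
Proof.
move=> /polytimeP [p fb [t tb pt]] /polytimeP [q gb [u ub qu]].
apply/polytimeP; exists (PPair p q); first exact: (poly_boundedS (poly_boundedD fb gb)).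
exists (fun i => (t i + u i).+1); first exact: poly_boundedS (poly_boundedD tb ub).
move=> i; have [s st es] := pt i; have [v vu ev] := qu i.
by exists (s + v).+1; [lia | constructor].
Qed.

Lemma polytime_const c : PT (fun=> c).
Proof.
by elim: c => [|a IHa b IHb]; [exact: polytime_leaf | exact: polytime_node].
Qed.

(** The intermediate instances have their own presentation and size, so this also serves to change
    the input format. The cost of [g] is measured by [szJ], which therefore has to stay polynomial
    along [h]. *)
Lemma polytime_comp (J : Type) (inpJ : J -> tree) (szJ : J -> nat)
    (h : I -> J) (g : J -> tree) :
  PT (inpJ \o h) -> poly_bounded sz (szJ \o h) -> polytime inpJ szJ g ->
  PT (g \o h).
Proof.
move=> /polytimeP [p fb [t tb pt]] hb /polytimeP [q gb [u ub qu]].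
apply/polytimeP; exists (PComp p q).
  exact: (poly_bounded_comp (h := h) gb hb).
exists (fun i => (t i + u (h i)).+1).
  exact: poly_boundedS (poly_boundedD tb (poly_bounded_comp (h := h) ub hb)).
move=> i; have [s st es] := pt i; have [v vu ev] := qu (h i).
by exists (s + v).+1; [lia | econstructor; eauto].
Qed.

Lemma polytime_thead f : PT f -> PT (thead \o f).
Proof.
move=> /polytimeP [p fb [t tb pt]]; apply/polytimeP; exists (PComp p PHead).
  by apply: poly_bounded_leq fb => i /=; case: (f i) => //= a b; lia.
exists (fun i => (t i + 1).+1).
  exact: poly_boundedS (poly_boundedD tb (poly_bounded_const _ _)).
move=> i; have [s st es] := pt i.
by exists (s + 1).+1; [lia | econstructor; [eauto | constructor]].
Qed.

Lemma polytime_ttail f : PT f -> PT (ttail \o f).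
Proof.
move=> /polytimeP [p fb [t tb pt]]; apply/polytimeP; exists (PComp p PTail).
  by apply: poly_bounded_leq fb => i /=; case: (f i) => //= a b; lia.
exists (fun i => (t i + 1).+1).
  exact: poly_boundedS (poly_boundedD tb (poly_bounded_const _ _)).
move=> i; have [s st es] := pt i.
by exists (s + 1).+1; [lia | econstructor; [eauto | constructor]].
Qed.

(* The loop counter is a right spine, so that both unary numbers and bit strings
   can drive the loop. *)
Lemma polytime_rec (T : I -> tree) (s : I -> nat -> tree) :
  PT T -> PT (s^~ 0) ->
  poly_bounded (fun p : I * nat => sz p.1 + p.2) (fun p => tsize (s p.1 p.2)) ->
  polytime (fun p : I * nat => Node (inp p.1) (Node (enc_nat p.2) (s p.1 p.2)))
    (fun p : I * nat => sz p.1 + p.2) (fun p => s p.1 p.2.+1) ->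
  PT (fun i => s i (spine (T i))).
Proof.
move=> /polytimeP [pT Tb [tT tTb epT]] /polytimeP [p0 sb [t0 t0b ep0]] sbd
       /polytimeP [q _ [u ub eq]].
(* The loop state is the remaining counter followed by exactly the input that the step program [q]
   expects. One run of the body pops the counter, keeps the input, increments the index and lets [q]
   compute the next accumulator. *)
pose st (c : tree) i j := Node c (Node (inp i) (Node (enc_nat j) (s i j))).
pose body := PPair (PComp PHead PTail) (PComp PTail
  (PPair PHead (PPair (PComp PTail (PComp PHead (PPair PLeaf PId))) q))).
have [d ud] := ub.
have spb : poly_bounded sz (fun i => spine (T i)).
  by apply: poly_bounded_leq Tb => i; exact: spine_tsize.
(* The index never exceeds the length of the counter, so this bounds every run of [q] uniformly. *)
pose V i := polybound d (sz i + spine (T i)).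
have Vb : poly_bounded sz V.
  exact: poly_bounded_polybound (poly_boundedD (poly_bounded_sz _) spb).
(* Invariant: the iterations done and those remaining add up to the initial counter. The constants
   30 and 10 leave room for the bookkeeping instructions. *)
have loop i c j : j + spine c = spine (T i) ->
    exists2 r, r <= spine c * (V i + 30) + 10 &
      eval (PWhile PHead body) (st c i j) (st Leaf i (spine (T i))) r.
  elim: c j => [|a _ b IH] j /=.
    rewrite addn0 => <-; exists 2 => //.
    by apply: EWhileStop; apply: (EHead (st Leaf i j)).
  move=> jb; have [|r rb er] := IH j.+1; first by lia.
  have [v vu ev] := eq (i, j).
  have vV : v <= V i.
    apply: leq_trans vu _; apply: leq_trans (ud (i, j)) _ => /=.
    by apply: polybound_mono; lia.
  have hc : eval PHead (st (Node a b) i j) (Node a b) 1 by apply: (EHead (st _ i j)).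
  eexists; last first.
    apply: (EWhileStep hc) er.
    apply: EPair; first by apply: EComp; [apply: (EHead (st _ i j)) | apply: (ETail (Node a b))].
    apply: EComp; first exact: (ETail (st _ i j)).
    apply: EPair; first exact: (EHead (Node (inp i) _)).
    apply: EPair ev.
    apply: EComp; first exact: (ETail (Node (inp i) _)).
    apply: EComp; first exact: (EHead (Node (enc_nat j) _)).
    by apply: EPair; constructor.
  by rewrite /=; nia.
apply/polytimeP.
exists (PComp (PPair pT (PPair PId (PPair PLeaf p0)))
  (PComp (PWhile PHead body) (PComp PTail (PComp PTail PTail)))).
  apply: (poly_bounded_comp (h := fun i => (i, spine (T i))) sbd).
  exact: poly_boundedD (poly_bounded_sz _) spb.
exists (fun i => tT i + t0 i + (spine (T i) * (V i + 30) + 30)).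
  apply: poly_boundedD; first exact: poly_boundedD.
  apply: poly_boundedD (poly_bounded_const _ _); apply: poly_boundedM => //.
  exact: poly_boundedD Vb (poly_bounded_const _ _).
move=> i; have [a at_ ea] := epT i; have [b bt eb] := ep0 i.
have [r rb er] := loop i (T i) 0 (add0n _).
eexists; last first.
  apply: EComp.
    by apply: (EPair ea _); apply: EPair; [apply: EId|apply: EPair eb; apply: ELeaf].
  apply: (EComp er _).
  apply: EComp; first exact: (ETail (st _ _ _)).
  apply: EComp; first exact: (ETail (Node (inp i) _)).
  exact: (ETail (Node (enc_nat _) _)).
by lia.
Qed.

End Polytime.

Lemma enc_nat_bounded (J : Type) (szJ f : J -> nat) :
  poly_bounded szJ f -> poly_bounded szJ (fun j => tsize (enc_nat (f j))).
Proof.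
move=> fb; apply: (poly_bounded_leq (g := fun j => (f j + f j).+1)) => [j|].
  by rewrite tsize_enc_nat -addnn.
by apply: poly_boundedS; exact: poly_boundedD.
Qed.

Section LoopContext.
Variables (I : Type) (inp : I -> tree) (sz : I -> nat) (s : I -> nat -> tree).

(** This is the input format that [polytime_rec] imposes on its step program; the lemmas of this
    section give access to its three components. *)
Definition loop_inp (p : I * nat) := Node (inp p.1) (Node (enc_nat p.2) (s p.1 p.2)).
Definition loop_sz (p : I * nat) := sz p.1 + p.2.

Hypothesis inp_bounded : poly_bounded sz (tsize \o inp).
Hypothesis s_bounded : poly_bounded loop_sz (fun p => tsize (s p.1 p.2)).

Lemma poly_bounded_loop f : poly_bounded sz f -> poly_bounded loop_sz (f \o fst).
Proof.
move=> fb; apply: (poly_bounded_comp (h := fst) fb).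
by apply: poly_bounded_leq (poly_bounded_sz loop_sz) => p; exact: leq_addr.
Qed.

Lemma poly_bounded_index : poly_bounded loop_sz snd.
Proof. by apply: poly_bounded_leq (poly_bounded_sz loop_sz) => p; exact: leq_addl. Qed.

Lemma loop_inp_bounded : poly_bounded loop_sz (tsize \o loop_inp).
Proof.
apply: (poly_bounded_leq (g := fun p => ((tsize \o inp) p.1 +
  (tsize (enc_nat p.2) + tsize (s p.1 p.2)).+1).+1)) => //.
apply: poly_boundedS; apply: poly_boundedD; first exact: (poly_bounded_loop inp_bounded).
apply: poly_boundedS; apply: (poly_boundedD _ s_bounded).
exact: enc_nat_bounded poly_bounded_index.
Qed.

Let idP := polytime_id loop_inp_bounded.

Lemma polytime_loop f : polytime inp sz f -> polytime loop_inp loop_sz (f \o fst).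
Proof.
move=> fP; apply: (polytime_comp (h := fst) _ _ fP); last first.
  exact: (poly_bounded_loop (poly_bounded_sz sz)).
exact: (polytime_thead idP).
Qed.

Lemma polytime_index : polytime loop_inp loop_sz (fun p => enc_nat p.2).
Proof. exact: (polytime_thead (polytime_ttail idP)). Qed.

Lemma polytime_acc : polytime loop_inp loop_sz (fun p => s p.1 p.2).
Proof. exact: (polytime_ttail (polytime_ttail idP)). Qed.

End LoopContext.

Section PolytimeNat.
Variables (I : Type) (inp : I -> tree) (sz : I -> nat).
Hypothesis inp_bounded : poly_bounded sz (tsize \o inp).
Implicit Types f g : I -> nat.
Local Notation PN f := (polytime inp sz (fun i => enc_nat (f i))).

(** Output size is charged and numbers are written in unary, so a number computed in polynomial time
    is itself polynomially bounded. *)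
Lemma polytime_nat_bounded f : PN f -> poly_bounded sz f.
Proof.
by move/polytime_bounded; apply: poly_bounded_leq => i /=; rewrite tsize_enc_nat; lia.
Qed.

Lemma polytime_nat_comp (l : nat -> nat) f : polytime_length l -> PN f -> PN (l \o f).
Proof.
move=> lP fP; apply: (polytime_comp (h := f) fP _ lP).
exact: polytime_nat_bounded fP.
Qed.

Lemma polytimeD f g : PN f -> PN g -> PN (fun i => f i + g i).
Proof.
move=> fP gP.
pose s := fun i j => enc_nat (j + g i).
have sb : poly_bounded (loop_sz sz) (fun p => tsize (s p.1 p.2)).
  apply: enc_nat_bounded; apply: (poly_boundedD (poly_bounded_index _) _).
  exact: (poly_bounded_loop (polytime_nat_bounded gP)).
apply: (@polytime_ext _ _ _ (fun i => enc_nat (spine (enc_nat (f i)) + g i))) => [i|].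
  by rewrite spine_enc_nat.
apply: (polytime_rec (s := s)) => //.
apply: (@polytime_ext _ _ _ (fun p => Node Leaf (enc_nat (p.2 + g p.1)))) => //.
apply: polytime_node; first exact: polytime_leaf.
exact: (polytime_acc (s := s) inp_bounded sb).
Qed.

End PolytimeNat.

Section PolytimeMul.
Variables (I : Type) (inp : I -> tree) (sz : I -> nat).
Hypothesis inp_bounded : poly_bounded sz (tsize \o inp).
Implicit Types f g : I -> nat.
Local Notation PN f := (polytime inp sz (fun i => enc_nat (f i))).

Lemma polytimeM f g : PN f -> PN g -> PN (fun i => f i * g i).
Proof.
move=> fP gP.
pose s := fun i j => enc_nat (j * g i).
have sb : poly_bounded (loop_sz sz) (fun p => tsize (s p.1 p.2)).
  apply: enc_nat_bounded; apply: (poly_boundedM (poly_bounded_index _) _).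
  exact: (poly_bounded_loop (polytime_nat_bounded gP)).
apply: (@polytime_ext _ _ _ (fun i => enc_nat (spine (enc_nat (f i)) * g i))) => [i|].
  by rewrite spine_enc_nat.
apply: (polytime_rec (s := s)) => //.
  exact: polytime_leaf.
apply: (@polytime_ext _ _ _ (fun p => enc_nat (g p.1 + p.2 * g p.1))) => [p|].
  by rewrite /s mulSn.
apply: (polytimeD (loop_inp_bounded (s := s) inp_bounded sb)).
- exact: (polytime_loop (s := s) inp_bounded sb gP).
- exact: (polytime_acc (s := s) inp_bounded sb).
Qed.

Lemma polytimeB f g : PN f -> PN g -> PN (fun i => f i - g i).
Proof.
move=> fP gP.
pose s := fun i j => enc_nat (f i - j).
have sb : poly_bounded (loop_sz sz) (fun p => tsize (s p.1 p.2)).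
  apply: enc_nat_bounded; apply: (poly_bounded_leq (g := f \o fst)) => [p|].
    exact: leq_subr.
  exact: (poly_bounded_loop (polytime_nat_bounded fP)).
apply: (@polytime_ext _ _ _ (fun i => enc_nat (f i - spine (enc_nat (g i))))) => [i|].
  by rewrite spine_enc_nat.
apply: (polytime_rec (s := s)) => //.
  by apply: polytime_ext fP => i; rewrite /s subn0.
apply: (@polytime_ext _ _ _ (fun p => ttail (enc_nat (f p.1 - p.2)))) => [p|].
  by rewrite /s subnS; case: (_ - _).
exact: (polytime_ttail (polytime_acc (s := s) inp_bounded sb)).
Qed.

End PolytimeMul.

Lemma polytime_size (I : Type) (inp : I -> tree) (sz : I -> nat) (x : I -> bits) :
  poly_bounded sz (tsize \o inp) -> polytime inp sz (fun i => enc_bits (x i)) ->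
  polytime inp sz (fun i => enc_nat (size (x i))).
Proof.
move=> ib xP.
pose s := fun (_ : I) j => enc_nat j.
have sb : poly_bounded (loop_sz sz) (fun p => tsize (s p.1 p.2)).
  exact: enc_nat_bounded (poly_bounded_index _).
apply: (@polytime_ext _ _ _ (fun i => enc_nat (spine (enc_bits (x i))))) => [i|].
  by rewrite spine_enc_bits.
apply: (polytime_rec (s := s)) => //; first exact: polytime_leaf.
apply: polytime_node; first exact: polytime_leaf.
exact: (polytime_acc (s := s) ib sb).
Qed.

(** * Generating circuits *)

Section PolytimeCircuit.
Variables (I : Type) (inp : I -> tree) (sz : I -> nat).
Hypothesis inp_bounded : poly_bounded sz (tsize \o inp).
Implicit Types (f g : I -> nat) (F G : I -> circ).
Local Notation PN f := (polytime inp sz (fun i => enc_nat (f i))).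
Local Notation PC F := (polytime inp sz (fun i => desc (F i))).

(** [desc] stores the wire counts in front of the code, so they are read off and no traversal of the
    circuit has to be programmed. *)
Lemma polytime_cin F : PC F -> PN (cin \o F).
Proof. exact: polytime_thead. Qed.

Lemma polytime_cout F : PC F -> PN (cout \o F).
Proof. by move=> FP; exact: (polytime_thead (polytime_ttail FP)). Qed.

Lemma polytime_enc_circ F : PC F -> polytime inp sz (enc_circ \o F).
Proof. by move=> FP; exact: (polytime_ttail (polytime_ttail FP)). Qed.

Lemma polytime_Wires f : PN f -> PC (Wires \o f).
Proof.
by move=> fP; do 3! [apply: polytime_node => //]; exact: polytime_const.
Qed.

Lemma polytime_Swap f g : PN f -> PN g -> PC (fun i => Swap (f i) (g i)).
Proof.
move=> fP gP; have fgP := polytimeD inp_bounded fP gP.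
by do 4! [apply: polytime_node => //]; exact: polytime_const.
Qed.

Lemma polytime_Box j f g : PN f -> PN g -> PC (fun i => Box j (f i) (g i)).
Proof.
move=> fP gP; apply: (polytime_node fP); apply: (polytime_node gP).
apply: (polytime_node (polytime_const _ _ (enc_nat 8))).
by apply: (polytime_node (polytime_const _ _ (enc_nat j))); exact: polytime_node.
Qed.

Lemma polytime_Seq F G : PC F -> PC G -> PC (fun i => Seq (F i) (G i)).
Proof.
move=> FP GP; apply: polytime_node; first exact: (polytime_cin FP).
apply: polytime_node; first exact: (polytime_cout GP).
apply: (polytime_node (polytime_const _ _ (enc_nat 9))).
exact: polytime_node (polytime_enc_circ FP) (polytime_enc_circ GP).
Qed.

Lemma polytime_Par F G : PC F -> PC G -> PC (fun i => Par (F i) (G i)).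
Proof.
move=> FP GP; apply: polytime_node.
  exact: (polytimeD inp_bounded (polytime_cin FP) (polytime_cin GP)).
apply: polytime_node.
  exact: (polytimeD inp_bounded (polytime_cout FP) (polytime_cout GP)).
apply: (polytime_node (polytime_const _ _ (enc_nat 10))).
exact: polytime_node (polytime_enc_circ FP) (polytime_enc_circ GP).
Qed.

End PolytimeCircuit.

(** The wire counts of the composite already occur in the headers of its parts, so composing costs
    only a constant; 30 is a generous one. *)
Lemma csize_Seq c d : csize (Seq c d) <= csize c + csize d + 30.
Proof. by rewrite /csize /desc /= !tsize_enc_nat; lia. Qed.

Lemma csize_Par c d : csize (Par c d) <= csize c + csize d + 30.
Proof. by rewrite /csize /desc /= !tsize_enc_nat; lia. Qed.

Lemma csize_Wires a : csize (Wires a) <= 6 * a + 30.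
Proof. by rewrite /csize /desc /= !tsize_enc_nat; lia. Qed.

Lemma csize_Swap a b : csize (Swap a b) <= 6 * (a + b) + 30.
Proof. by rewrite /csize /desc /= !tsize_enc_nat; lia. Qed.

Definition layer (c : circ) (k : nat) : circ := iter k (Par c) (Wires 0).

(* From (a, t) to (z, a), where z is the outcome for t in the basis a. *)
Definition measured_gate : circ :=
  Seq (Par (Wires 1) (Seq GateT (Seq GateT (Seq GateH GateT))))
 (Seq GateCNOT
 (Seq (Par (Wires 1) (Seq GateT (Seq GateT (Seq GateT (Seq GateT
         (Seq GateT (Seq GateT (Seq GateT GateH))))))))
 (Seq (Swap 1 1) (Par Measure Measure)))).

(* Input: a basis a and [j] qubits; output: the [j] outcomes, then a. *)
Fixpoint measured_block (j : nat) : circ :=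
  if j is i.+1 then Seq (Par measured_gate (Wires i)) (Par (Wires 1) (measured_block i))
  else Measure.

(* Input: [j] bases, then [j] blocks of [n] qubits; output: the bases, then the
   outcomes. *)
Fixpoint measured_blocks (n j : nat) : circ :=
  if j is i.+1 then
    Seq (Par (Wires 1) (Par (Swap i n) (Wires (i * n))))
   (Seq (Par (measured_block n) (measured_blocks n i))
        (Par (Swap n i.+1) (Wires (i * n))))
  else Wires 0.

(* From the registers P and C to a1, a2 and the outcome z on P; [B] maps C to a
   transcript. *)
Definition commit_circ (l1 m l2 n : nat) (B : circ) : circ :=
  let lp := (l1 * n)%N in
  Seq (Swap lp m)
 (Seq (Par (Seq B (Par (Wires l1) (Par (layer Discard m) (Wires l2)))) (Wires lp))
 (Seq (Par (Wires l1) (Swap l2 lp))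
 (Seq (Par (measured_blocks n l1) (Wires l2))
      (Par (Wires l1) (Swap lp l2))))).

(** The circuit counterpart of [classical_oracle]. *)
Definition measured (i o : nat) (c : circ) : circ :=
  Seq (layer Measure i) (Seq c (layer Measure o)).

(** The circuit counterpart of [interaction]: the verifier's operations around the reply, with p
    private wires passing by. *)
Definition sandwich (A B : circ) (p : nat) (C : circ) : circ :=
  Seq A (Seq (Par B (Wires p)) C).

Lemma csize_layer c j : csize (layer c j) <= j * (csize c + 30) + 30.
Proof.
elim: j => [|j IH]; first exact: (csize_Wires 0).
by have := csize_Par c (layer c j); rewrite /= -/(layer c j); lia.
Qed.

Lemma csize_measured_block j :
  csize (measured_block j) <= j * (csize measured_gate + 6 * j + 300) + csize Measure.
Proof.
elim: j => [|j IH] //=.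
have := csize_Seq (Par measured_gate (Wires j)) (Par (Wires 1) (measured_block j)).
have := csize_Par measured_gate (Wires j); have := csize_Par (Wires 1) (measured_block j).
have := csize_Wires j; have := csize_Wires 1; move: IH.
by move: (csize _) (csize _) (csize _) (csize _) (csize _) (csize _) (csize _); nia.
Qed.

Lemma csize_measured_blocks n j :
  csize (measured_blocks n j) <=
    j * (csize (measured_block n) + 30 * (j * n + j + n) + 400) + 30.
Proof.
elim: j => [|j IH]; first exact: (csize_Wires 0).
rewrite [measured_blocks n j.+1]/=.
set A := Par (Wires 1) _; set B := Par (measured_block n) _; set C := Par (Swap _ _) _.
have := csize_Seq A (Seq B C); have := csize_Seq B C.
have : csize A <= 6 + 30 + (6 * (j + n) + 30 + (6 * (j * n) + 30) + 30) + 30.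
  apply: leq_trans (csize_Par _ _) _; rewrite leq_add2r leq_add ?(csize_Wires 1) //.
  by apply: leq_trans (csize_Par _ _) _; rewrite leq_add2r leq_add ?csize_Swap ?csize_Wires.
have : csize C <= 6 * (n + j.+1) + 30 + (6 * (j * n) + 30) + 30.
  by apply: leq_trans (csize_Par _ _) _; rewrite leq_add2r leq_add ?csize_Swap ?csize_Wires.
have : csize B <= csize (measured_block n) + csize (measured_blocks n j) + 30.
  exact: csize_Par.
(* The cost per block in the bound itself grows with the number of blocks. The induction hypothesis
   is first weakened from the cost X at j to the cost X' at j + 1, and the products are then
   generalized so that the rest is linear. *)
rewrite [j.+1 * (_ + 400)]mulSn.
set X := _ + 400 in IH; set X' := (_ + 400) in |- * => hB hC hA hBC hABC.
have X'E : X' = csize (measured_block n) + 30 * (j * n + n + (j + 1) + n) + 400.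
  by rewrite /X' mulSn; lia.
have XX' : j * X <= j * X' by rewrite leq_mul2l X'E /X; apply/orP; right; lia.
move: XX' IH; move: (j * X) (j * X') => u v XX' IH.
rewrite X'E; move: hABC hBC hA hB hC; move: (j * n) => jn.
lia.
Qed.

Section PolytimeFamilies.
Variables (I : Type) (inp : I -> tree) (sz : I -> nat).
Hypothesis inp_bounded : poly_bounded sz (tsize \o inp).
Implicit Types (f g : I -> nat) (F G : I -> circ).
Local Notation PN f := (polytime inp sz (fun i => enc_nat (f i))).
Local Notation PC F := (polytime inp sz (fun i => desc (F i))).

(** As in the next two lemmas, the description of the circuit built so far is the accumulator of the
    loop, and the [csize] bounds provide the control on its size that [polytime_rec] asks for. *)
Lemma polytime_layer c f : PN f -> PC (fun i => layer c (f i)).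
Proof.
move=> fP; pose s (_ : I) j := desc (layer c j).
have sb : poly_bounded (loop_sz sz) (fun p => tsize (s p.1 p.2)).
  apply: (poly_bounded_leq (g := fun p => p.2 * (csize c + 30) + 30)) => [p|].
    exact: csize_layer.
  apply: poly_boundedD (poly_bounded_const _ _); apply: poly_boundedM (poly_bounded_const _ _).
  exact: poly_bounded_index.
apply: (@polytime_ext _ _ _ (fun i => s i (spine (enc_nat (f i))))) => [i|].
  by rewrite spine_enc_nat.
apply: polytime_rec => //; first exact: polytime_const.
apply: (polytime_Par (loop_inp_bounded (s := s) inp_bounded sb) (F := fun=> c)
  (G := fun p => layer c p.2)); first exact: polytime_const.
exact: (polytime_acc (s := s) inp_bounded sb).
Qed.

Lemma polytime_measured_block f : PN f -> PC (fun i => measured_block (f i)).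
Proof.
move=> fP; pose s (_ : I) j := desc (measured_block j).
have sb : poly_bounded (loop_sz sz) (fun p => tsize (s p.1 p.2)).
  apply: poly_bounded_leq (fun p => csize_measured_block p.2) _.
  have ib := poly_bounded_index sz; have cb := poly_bounded_const (loop_sz sz).
  apply: poly_boundedD (cb _); apply: (poly_boundedM ib _).
  apply: poly_boundedD (cb _); apply: (poly_boundedD (cb _) _).
  exact: poly_boundedM (cb _) ib.
apply: (@polytime_ext _ _ _ (fun i => s i (spine (enc_nat (f i))))) => [i|].
  by rewrite spine_enc_nat.
apply: polytime_rec => //; first exact: polytime_const.
have lb := loop_inp_bounded (s := s) inp_bounded sb.
apply: (polytime_Seq (F := fun p => Par measured_gate (Wires p.2))
  (G := fun p => Par (Wires 1) (measured_block p.2))).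
  apply: (polytime_Par lb (F := fun=> measured_gate)); first exact: polytime_const.
  exact: (polytime_Wires (polytime_index (s := s) inp_bounded sb)).
apply: (polytime_Par lb (F := fun=> Wires 1)); first exact: polytime_const.
exact: (polytime_acc (s := s) inp_bounded sb).
Qed.

Lemma polytime_measured_blocks f g :
  PN g -> PN f -> PC (fun i => measured_blocks (g i) (f i)).
Proof.
move=> gP fP; pose s i j := desc (measured_blocks (g i) j).
have sb : poly_bounded (loop_sz sz) (fun p => tsize (s p.1 p.2)).
  apply: poly_bounded_leq (fun p => csize_measured_blocks (g p.1) p.2) _.
  have ib := poly_bounded_index sz; have cb := poly_bounded_const (loop_sz sz).
  have gb := poly_bounded_loop (polytime_nat_bounded gP).
  have bb := poly_bounded_loop (polytime_bounded (polytime_measured_block gP)).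
  apply: poly_boundedD (cb _); apply: (poly_boundedM ib _).
  apply: poly_boundedD (cb _); apply: (poly_boundedD bb _); apply: (poly_boundedM (cb _) _).
  exact: poly_boundedD (poly_boundedD (poly_boundedM ib gb) ib) gb.
apply: (@polytime_ext _ _ _ (fun i => s i (spine (enc_nat (f i))))) => [i|].
  by rewrite spine_enc_nat.
apply: polytime_rec => //; first exact: (polytime_const _ _ (desc (Wires 0))).
have lb := loop_inp_bounded (s := s) inp_bounded sb.
have iP := polytime_index (s := s) inp_bounded sb.
have gP' := polytime_loop (s := s) inp_bounded sb gP.
have igP := polytimeM lb iP gP'.
apply: polytime_Seq.
  apply: (polytime_Par lb); first exact: (polytime_const _ _ (desc (Wires 1))).
  exact: (polytime_Par lb (polytime_Swap lb iP gP') (polytime_Wires igP)).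
apply: polytime_Seq.
  apply: (polytime_Par lb).
    exact: (polytime_loop (s := s) inp_bounded sb (polytime_measured_block gP)).
  exact: (polytime_acc (s := s) inp_bounded sb).
apply: (polytime_Par lb); last exact: polytime_Wires igP.
apply: (polytime_Swap lb gP').
by apply: (polytime_node (polytime_const _ _ Leaf)).
Qed.

Lemma polytime_commit_circ (l1 m l2 n : I -> nat) (B : I -> circ) :
  PN l1 -> PN m -> PN l2 -> PN n -> PC B ->
  PC (fun i => commit_circ (l1 i) (m i) (l2 i) (n i) (B i)).
Proof.
move=> l1P mP l2P nP BP; have lpP := polytimeM inp_bounded l1P nP.
have PP := polytime_Par inp_bounded; have SP := polytime_Swap inp_bounded.
have l1W := polytime_Wires l1P; have l2W := polytime_Wires l2P; have lpW := polytime_Wires lpP.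
apply: (polytime_Seq (SP _ _ lpP mP)).
apply: polytime_Seq.
  apply: (PP _ _ _ lpW); apply: (polytime_Seq BP); apply: (PP _ _ l1W).
  by apply: (PP _ _ _ l2W); exact: polytime_layer.
apply: (polytime_Seq (PP _ _ l1W (SP _ _ l2P lpP))).
apply: (polytime_Seq _ (PP _ _ l1W (SP _ _ lpP l2P))).
by apply: (PP _ _ _ l2W); exact: polytime_measured_blocks.
Qed.

Lemma polytime_measured f g F :
  PN f -> PN g -> PC F -> PC (fun i => measured (f i) (g i) (F i)).
Proof.
move=> fP gP FP; apply: polytime_Seq; first exact: polytime_layer.
by apply: (polytime_Seq FP); exact: polytime_layer.
Qed.

Lemma polytime_sandwich f (A B C : I -> circ) :
  PC A -> PC B -> PN f -> PC C -> PC (fun i => sandwich (A i) (B i) (f i) (C i)).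
Proof.
move=> AP BP fP CP; apply: (polytime_Seq AP).
apply: (polytime_Seq _ CP); apply: (polytime_Par inp_bounded BP); exact: polytime_Wires.
Qed.

End PolytimeFamilies.

(** * Well-formed circuits *)

Lemma circuit_Seq sig a b c C1 C2 :
  circuit sig a b C1 -> circuit sig b c C2 -> circuit sig a c (Seq C1 C2).
Proof. by move=> [w1 <- <-] [w2 i2 <-]; split; rewrite //= w1 w2 i2 eqxx. Qed.

Lemma circuit_Par sig a b c d C1 C2 :
  circuit sig a b C1 -> circuit sig c d C2 -> circuit sig (a + c) (b + d) (Par C1 C2).
Proof. by move=> [w1 <- <-] [w2 <- <-]; split; rewrite //= w1 w2. Qed.

Lemma circuit_Wires sig a : circuit sig a a (Wires a). Proof. by []. Qed.

Lemma circuit_Swap sig a b : circuit sig (a + b) (b + a) (Swap a b).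
Proof. by split=> //=; rewrite addnC. Qed.

Lemma circuit_Box (sig : signature) j a b :
  sig j = Some (a, b) -> circuit sig a b (Box j a b).
Proof. by move=> sj; split; rewrite //= sj. Qed.

Lemma circuit_no_box sig a b c : circuit no_box a b c -> circuit sig a b c.
Proof.
move=> [w <- <-]; split=> // {a b}; elim: c w => //= c1 IH1 c2 IH2.
  by move=> /and3P[/IH1-> /IH2-> ->].
by move=> /andP[/IH1-> /IH2->].
Qed.

Lemma circuit_cast sig a b a' b' c :
  a = a' -> b = b' -> circuit sig a b c -> circuit sig a' b' c.
Proof. by move=> -> ->. Qed.

Lemma circuit_layer sig a b c k :
  circuit sig a b c -> circuit sig (k * a) (k * b) (layer c k).
Proof.
by move=> cP; elim: k => [|k IH]; [exact: circuit_Wires | exact: circuit_Par].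
Qed.

Lemma circuit_measured_block sig j : circuit sig j.+1 j.+1 (measured_block j).
Proof.
elim: j => [|j IH] //.
apply: (@circuit_Seq _ _ (2 + j)); first exact: (@circuit_Par _ 2 2 j j).
exact: (@circuit_Par _ 1 1 j.+1 j.+1).
Qed.

Lemma circuit_measured_blocks sig n j :
  circuit sig (j + j * n) (j + j * n) (measured_blocks n j).
Proof.
elim: j => [|j IH] //=.
apply: (@circuit_Seq _ _ (1 + (n + j + j * n))).
  apply: (@circuit_cast _ (1 + (j + n + j * n)) (1 + (n + j + j * n))) => //; first lia.
  apply: circuit_Par; first exact: circuit_Wires.
  by apply: circuit_Par; [exact: circuit_Swap | exact: circuit_Wires].
apply: (@circuit_Seq _ _ (n.+1 + (j + j * n))).
  apply: (@circuit_cast _ (n.+1 + (j + j * n)) (n.+1 + (j + j * n))) => //; first lia.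
  exact: circuit_Par (circuit_measured_block _ _) IH.
apply: (@circuit_cast _ (n + j.+1 + j * n) (j.+1 + n + j * n)); [lia | lia |].
by apply: circuit_Par; [exact: circuit_Swap | exact: circuit_Wires].
Qed.

Lemma circuit_commit sig l1 m l2 n B :
  circuit sig m (l1 + m + l2) B ->
  circuit sig (l1 * n + m) (l1 + l2 + l1 * n) (commit_circ l1 m l2 n B).
Proof.
move=> BP; rewrite /commit_circ; move: (circuit_measured_blocks sig n l1).
move: (l1 * n) => lp MP.
have W := circuit_Wires sig; have S := circuit_Swap sig.
apply: (circuit_Seq (S _ _)).
apply: (@circuit_Seq _ _ (l1 + (0 + l2) + lp)).
  apply: (circuit_Par _ (W _)); apply: (circuit_Seq BP).
  apply: (@circuit_cast _ (l1 + (m * 1 + l2)) (l1 + (m * 0 + l2))); [lia | lia |].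
  apply: (circuit_Par (W _)); apply: (circuit_Par _ (W _)).
  exact: (@circuit_layer _ 1 0).
apply: (@circuit_Seq _ _ (l1 + lp + l2)).
  apply: (@circuit_cast _ (l1 + (l2 + lp)) (l1 + (lp + l2))); [lia | lia |].
  exact: circuit_Par (W _) (S _ _).
apply: (@circuit_Seq _ _ (l1 + lp + l2)); first exact: circuit_Par MP (W _).
apply: (@circuit_cast _ (l1 + (lp + l2)) (l1 + (l2 + lp))); [lia | lia |].
exact: circuit_Par (W _) (S _ _).
Qed.

Lemma circuit_measured sig i o c : circuit sig i o c -> circuit sig i o (measured i o c).
Proof.
have L k : circuit sig k k (layer Measure k).
  by have := @circuit_layer sig 1 1 Measure k; rewrite !muln1; apply.
by move=> cP; exact: circuit_Seq (L i) (circuit_Seq cP (L o)).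
Qed.

Lemma circuit_sandwich sig a b c d p A B C :
  circuit sig a (b + p) A -> circuit sig b c B -> circuit sig (c + p) d C ->
  circuit sig a d (sandwich A B p C).
Proof.
move=> AP BP CP; exact: circuit_Seq AP (circuit_Seq (circuit_Par BP (circuit_Wires _ _)) CP).
Qed.

Lemma calls_layer i c k : calls i (layer c k) = k * calls i c.
Proof. by elim: k => //= k; rewrite -/(layer c k) => ->; rewrite mulSn. Qed.

Lemma calls_measured_blocks i n j : calls i (measured_blocks n j) = 0.
Proof.
elim: j => //= j ->; rewrite !addn0.
by elim: n => //= n ->.
Qed.

Lemma calls_commit i l1 m l2 n B : calls i (commit_circ l1 m l2 n B) = calls i B.
Proof. by rewrite /= calls_layer calls_measured_blocks /= muln0 !addn0. Qed.
(** * Superoperators of circuits *)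

Import GRing.Theory Num.Theory.
Local Open Scope ring_scope.
Local Notation "x ^*" := (Num.conj x) : ring_scope.

Section Semantics.
Variable R : realType.
Implicit Types (K : sop R) (env : nat -> sop R).

Lemma sem_no_box env env' c : wf no_box c -> sem env c = sem env' c.
Proof.
elim: c => //= c1 IH1 c2 IH2.
  by move=> /and3P[/IH1-> /IH2-> _].
by move=> /andP[/IH1-> /IH2->].
Qed.

(** Entries at lists of the wrong length are meaningless and never enter a sum over tuples, so
    circuits are compared up to this relation and not as functions. *)
Definition eq_sop (m n : nat) (K K' : sop R) : Prop :=
  forall y y' x x' : bits, size y = n -> size y' = n -> size x = m -> size x' = m ->
    K y y' x x' = K' y y' x x'.

Lemma eq_seq_sop a b c K1 K1' K2 K2' :
  eq_sop a b K1 K1' -> eq_sop b c K2 K2' ->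
  eq_sop a c (seq_sop b K1 K2) (seq_sop b K1' K2').
Proof.
move=> E1 E2 y y' x x' sy sy' sx sx'; apply: eq_bigr => u _; apply: eq_bigr => u' _.
by rewrite E1 ?E2 ?size_tuple.
Qed.

Lemma eq_par_sop a b c d K1 K1' K2 K2' :
  eq_sop a b K1 K1' -> eq_sop c d K2 K2' ->
  eq_sop (a + c) (b + d) (par_sop a b K1 K2) (par_sop a b K1' K2').
Proof.
move=> E1 E2 y y' x x' sy sy' sx sx'; rewrite /par_sop.
by rewrite E1 ?E2 ?size_takel ?size_drop ?sy ?sy' ?sx ?sx' ?addKn ?leq_addr.
Qed.

Lemma eq_Pr1 m K K' rho : eq_sop m 1 K K' -> Pr1 m K rho = Pr1 m K' rho.
Proof.
move=> E; congr complex.Re; apply: eq_bigr => x _; apply: eq_bigr => x' _.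
by rewrite E ?size_tuple.
Qed.

Lemma sum_tuple_cat a b (F : bits -> (R[i])%C) :
  \sum_(u : (a + b).-tuple bool) F u =
  \sum_(u1 : a.-tuple bool) \sum_(u2 : b.-tuple bool) F (u1 ++ u2).
Proof.
rewrite pair_big /=.
rewrite (reindex (fun p : a.-tuple bool * b.-tuple bool => cat_tuple p.1 p.2)) //=.
apply: onW_bij; apply: inj_card_bij => [[u1 u2] [v1 v2] /(congr1 val) /= /eqP|].
  by rewrite eqseq_cat ?size_tuple // => /andP[/eqP/val_inj-> /eqP/val_inj->].
by rewrite card_prod !card_tuple expnD.
Qed.

Lemma sum_tuple_delta n (v : bits) (F : bits -> (R[i])%C) :
  size v = n -> \sum_(u : n.-tuple bool) (tval u == v)%:R * F u = F v.
Proof.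
move=> sv; have [t ->] : exists t : n.-tuple bool, v = t.
  by exists (Tuple (introT eqP sv)).
rewrite (bigD1 t) //= eqxx mul1r big1 ?addr0 // => u /negPf ut.
by rewrite (inj_eq val_inj) ut mul0r.
Qed.

(** [F] is indexed by tuples but [G] by plain lists, so the double sum can be evaluated at v and v'
    without packaging these as tuples. *)
Lemma sum_tuple_delta2 n (v v' : bits) (F : n.-tuple bool -> n.-tuple bool -> (R[i])%C)
    (G : bits -> bits -> (R[i])%C) :
  size v = n -> size v' = n ->
  (forall u u', F u u' = (tval u == v)%:R * ((tval u' == v')%:R * G u u')) ->
  \sum_(u : n.-tuple bool) \sum_(u' : n.-tuple bool) F u u' = G v v'.
Proof.
move=> sv sv' FG; rewrite -(sum_tuple_delta (fun u => G u v') sv).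
apply: eq_bigr => u _; rewrite -(sum_tuple_delta (G u) sv') mulr_sumr.
by apply: eq_bigr => u' _; rewrite FG.
Qed.

Lemma sum_tuple1 (F : 1.-tuple bool -> (R[i])%C) :
  \sum_u F u = F [tuple false] + F [tuple true].
Proof.
rewrite (reindex (fun b => [tuple b])) /=; first by rewrite big_bool addrC.
exists (fun t : 1.-tuple bool => tuple.thead t) => [b _|t _]; first by rewrite theadE.
by case/tupleP: t => b t; rewrite theadE (tuple0 t); apply: val_inj.
Qed.

Lemma conjc_bool (b : bool) : (b%:R : (R[i])%C)^* = b%:R.
Proof. exact: rmorph_nat. Qed.

Lemma mulr_bool (a b : bool) : a%:R * b%:R = (a && b)%:R :> (R[i])%C.
Proof. by rewrite -natrM mulnb. Qed.

(* A superoperator that merely permutes wires acts on basis states, forwards and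
   backwards; the two predicates follow a pair of basis states through it. *)
Definition sends K n (x x' v v' : bits) : Prop :=
  [/\ size v = n, size v' = n & forall y y' : bits, size y = n -> size y' = n ->
    K y y' x x' = (y == v)%:R * (y' == v')%:R].

Definition receives K m (y y' v v' : bits) : Prop :=
  [/\ size v = m, size v' = m & forall x x' : bits, size x = m -> size x' = m ->
    K y y' x x' = (x == v)%:R * (x' == v')%:R].

Lemma cat3_split a b c (y : bits) : size y = (a + b + c)%N -> exists y1 y2 y3,
  [/\ y = y1 ++ y2 ++ y3, size y1 = a, size y2 = b & size y3 = c].
Proof.
move=> sy; exists (take a y), (take b (drop a y)), (drop b (drop a y)).
rewrite !cat_take_drop; split; rewrite ?size_take_min ?size_drop ?sy //; lia.
Qed.

Lemma cat2_split a b (y : bits) : size y = (a + b)%N -> exists y1 y2,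
  [/\ y = y1 ++ y2, size y1 = a & size y2 = b].
Proof.
move=> sy; exists (take a y), (drop a y).
by rewrite cat_take_drop size_takel ?size_drop ?sy ?addKn ?leq_addr.
Qed.

Lemma eq_take_drop a (x1 x2 y : bits) :
  size x1 = a -> (take a y == x1) && (drop a y == x2) = (y == x1 ++ x2).
Proof.
move=> s1; apply/andP/eqP => [[/eqP<- /eqP<-]|->]; first by rewrite cat_take_drop.
by rewrite take_size_cat // drop_size_cat.
Qed.

Lemma sends_Wires n x x' : size x = n -> size x' = n -> sends (@id_sop R) n x x' x x'.
Proof. by move=> sx sx'; split=> // y y' _ _; rewrite /id_sop /unitary_sop conjc_bool. Qed.

Lemma receives_Wires n x x' : size x = n -> size x' = n -> receives (@id_sop R) n x x' x x'.
Proof.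
move=> sx sx'; split=> // y y' _ _.
by rewrite /id_sop /unitary_sop conjc_bool eq_sym [x' == _]eq_sym.
Qed.

Lemma sends_Swap env a b x1 x2 x1' x2' :
  size x1 = a -> size x1' = a -> size x2 = b -> size x2' = b ->
  sends (sem env (Swap a b)) (a + b) (x1 ++ x2) (x1' ++ x2') (x2 ++ x1) (x2' ++ x1').
Proof.
move=> s1 s1' s2 s2'; split; rewrite ?size_cat ?s1 ?s1' ?s2 ?s2' ?[(b + a)%N]addnC // => y y' _ _.
by rewrite /= /unitary_sop conjc_bool !take_size_cat // !drop_size_cat.
Qed.

Lemma receives_Swap env a b y1 y2 y1' y2' :
  size y1 = b -> size y1' = b -> size y2 = a -> size y2' = a ->
  receives (sem env (Swap a b)) (a + b) (y1 ++ y2) (y1' ++ y2') (y2 ++ y1) (y2' ++ y1').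
Proof.
move=> s1 s1' s2 s2'; split; rewrite ?size_cat ?s1 ?s1' ?s2 ?s2' // => x x' sx sx'.
have E (u w1 w2 : bits) : size u = a + b -> size w1 = b -> size w2 = a ->
    (w1 ++ w2 == drop a u ++ take a u) = (u == w2 ++ w1).
  move=> su t1 t2; rewrite eqseq_cat ?size_drop ?su ?addKn //.
  by rewrite [w1 == _]eq_sym [w2 == _]eq_sym andbC eq_take_drop.
by rewrite /= /unitary_sop conjc_bool !E.
Qed.

Lemma sends_par a b d K1 K2 x1 x1' x2 x2' v1 v1' v2 v2' :
  size x1 = a -> size x1' = a ->
  sends K1 b x1 x1' v1 v1' -> sends K2 d x2 x2' v2 v2' ->
  sends (par_sop a b K1 K2) (b + d) (x1 ++ x2) (x1' ++ x2') (v1 ++ v2) (v1' ++ v2').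
Proof.
move=> s1 s1' [t1 t1' E1] [t2 t2' E2].
split; rewrite ?size_cat ?t1 ?t1' ?t2 ?t2' // => y y' sy sy'.
rewrite /par_sop !take_size_cat // !drop_size_cat // E1 ?E2 ?size_takel ?size_drop
  ?sy ?sy' ?addKn ?leq_addr //.
by rewrite mulrACA !mulr_bool !eq_take_drop.
Qed.

Lemma receives_par a b c K1 K2 y1 y1' y2 y2' v1 v1' v2 v2' :
  size y1 = b -> size y1' = b ->
  receives K1 a y1 y1' v1 v1' -> receives K2 c y2 y2' v2 v2' ->
  receives (par_sop a b K1 K2) (a + c) (y1 ++ y2) (y1' ++ y2') (v1 ++ v2) (v1' ++ v2').
Proof.
move=> s1 s1' [t1 t1' E1] [t2 t2' E2].
split; rewrite ?size_cat ?t1 ?t1' ?t2 ?t2' // => y y' sy sy'.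
rewrite /par_sop !take_size_cat // !drop_size_cat // E1 ?E2 ?size_takel ?size_drop
  ?sy ?sy' ?addKn ?leq_addr //.
by rewrite mulrACA !mulr_bool !eq_take_drop.
Qed.

Lemma seq_sends b K1 K2 y y' x x' v v' :
  sends K1 b x x' v v' -> seq_sop b K1 K2 y y' x x' = K2 y y' v v'.
Proof.
move=> [sv sv' E]; apply: (sum_tuple_delta2 (G := fun u u' => K2 y y' u u') sv sv').
by move=> u u'; rewrite E ?size_tuple // mulrC -mulrA.
Qed.

Lemma seq_receives b K1 K2 y y' x x' v v' :
  receives K2 b y y' v v' -> seq_sop b K1 K2 y y' x x' = K1 v v' x x'.
Proof.
move=> [sv sv' E]; apply: (sum_tuple_delta2 (G := fun u u' => K1 u u' x x') sv sv').
by move=> u u'; rewrite E ?size_tuple // -mulrA.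
Qed.

Lemma par_sop_cat a b K1 K2 y1 y2 y1' y2' x1 x2 x1' x2' :
  size y1 = b -> size y1' = b -> size x1 = a -> size x1' = a ->
  par_sop a b K1 K2 (y1 ++ y2) (y1' ++ y2') (x1 ++ x2) (x1' ++ x2') =
  K1 y1 y1' x1 x1' * K2 y2 y2' x2 x2'.
Proof. by move=> *; rewrite /par_sop !take_size_cat // !drop_size_cat. Qed.

(** The sum over the intermediate register splits in two; the half belonging to the idle wires
    collapses to their input value, leaving the wires on which [K1] acts. *)
Lemma seq_par_Wires a b c K1 K2 y y' x1 x1' x2 x2' :
  size x1 = a -> size x1' = a -> size x2 = c -> size x2' = c ->
  seq_sop (b + c) (par_sop a b K1 (@id_sop R)) K2 y y' (x1 ++ x2) (x1' ++ x2') =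
  \sum_(u : b.-tuple bool) \sum_(u' : b.-tuple bool)
    K2 y y' (u ++ x2) (u' ++ x2') * K1 u u' x1 x1'.
Proof.
move=> s1 s1' s2 s2'.
pose f u u' := K2 y y' u u' * par_sop a b K1 (@id_sop R) u u' (x1 ++ x2) (x1' ++ x2').
rewrite /seq_sop (sum_tuple_cat _ _ (fun u => \sum_(u' : (b + c).-tuple bool) f u u')).
apply: eq_bigr => u _.
under eq_bigr => v _ do rewrite (sum_tuple_cat _ _ (f (u ++ v))).
rewrite exchange_big /=; apply: eq_bigr => u' _.
apply: (sum_tuple_delta2 (G := fun v v' => K2 y y' (u ++ v) (u' ++ v') * K1 u u' x1 x1') s2 s2').
move=> v v'; rewrite /f par_sop_cat ?size_tuple //.
by rewrite /id_sop /unitary_sop conjc_bool; ring.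
Qed.

End Semantics.

(** * Measuring one qubit in a basis held by another *)

Section MeasuredGate.
Variable R : realType.
Implicit Types (K : sop R) (env : nat -> sop R).

Lemma seq_Wires_par a b c K1 K2 y y' x1 x1' x2 x2' :
  size x1 = c -> size x1' = c -> size x2 = a -> size x2' = a ->
  seq_sop (c + b) (par_sop c c (@id_sop R) K1) K2 y y' (x1 ++ x2) (x1' ++ x2') =
  \sum_(u : b.-tuple bool) \sum_(u' : b.-tuple bool)
    K2 y y' (x1 ++ u) (x1' ++ u') * K1 u u' x2 x2'.
Proof.
move=> s1 s1' s2 s2'.
pose f u u' := K2 y y' u u' * par_sop c c (@id_sop R) K1 u u' (x1 ++ x2) (x1' ++ x2').
rewrite /seq_sop (sum_tuple_cat _ _ (fun u => \sum_(u' : (c + b).-tuple bool) f u u')).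
rewrite exchange_big /=; apply: eq_bigr => u _.
under eq_bigr => v _ do rewrite (sum_tuple_cat _ _ (f (v ++ u))) exchange_big.
rewrite exchange_big /=; apply: eq_bigr => u' _.
apply: (sum_tuple_delta2 (G := fun v v' => K2 y y' (v ++ u) (v' ++ u') * K1 u u' x2 x2') s1 s1').
move=> v v'; rewrite /f par_sop_cat ?size_tuple //.
by rewrite /id_sop /unitary_sop conjc_bool; ring.
Qed.

Lemma conjcM (x y : (R[i])%C) : (x * y)^* = x^* * y^*.
Proof. exact: rmorphM. Qed.

(** The eighth root of unity exp(i pi / 4), the phase applied by the T gate. *)
Definition omega : (R[i])%C := (Complex (Num.sqrt 2)^-1 (Num.sqrt 2)^-1).
Definition phase (s : bool) : (R[i])%C := if s then omega else 1.
Definition had1 (z s : bool) : (R[i])%C := ((Num.sqrt 2)^-1)%:C%C * (-1) ^+ (z && s).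

Lemma hadamard1 a z t :
  hadamard R [:: a] [:: z] [:: t] = if a then had1 z t else (z == t)%:R.
Proof. by rewrite /hadamard big_ord_recl big_ord0 mulr1 /=; case: a. Qed.

Lemma sem_T env : sem env GateT =
  unitary_sop (fun y x => (y == x)%:R * phase (x == [:: true])).
Proof. by []. Qed.

Lemma eqb_seq1 b : ([:: b] == [:: true]) = b.
Proof. by case: b. Qed.

Lemma seq_T_l env K y y' t t' :
  seq_sop 1 (sem env GateT) K y y' [:: t] [:: t'] =
  K y y' [:: t] [:: t'] * (phase t * (phase t')^*).
Proof.
apply: (sum_tuple_delta2 (v := [:: t]) (v' := [:: t'])
  (G := fun u u' => K y y' u u' * (phase t * (phase t')^*))) => // u u'.
rewrite sem_T /unitary_sop !conjcM conjc_bool !eqb_seq1; ring.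
Qed.

Lemma seq_T_r env K z z' x x' :
  seq_sop 1 K (sem env GateT) [:: z] [:: z'] x x' =
  K [:: z] [:: z'] x x' * (phase z * (phase z')^*).
Proof.
apply: (sum_tuple_delta2 (v := [:: z]) (v' := [:: z'])
  (G := fun u u' => K u u' x x' * (phase z * (phase z')^*))) => // u u'.
rewrite sem_T /unitary_sop !conjcM conjc_bool.
rewrite [[:: z] == _]eq_sym [[:: z'] == _]eq_sym.
case: (tval u =P [:: z]) => [->|_]; last by rewrite !(mul0r, mulr0).
case: (tval u' =P [:: z']) => [->|_]; last by rewrite !(mul0r, mulr0).
by rewrite !eqb_seq1; ring.
Qed.

Lemma omega2 : omega ^+ 2 = 'i%C.
Proof.
have h : (Num.sqrt 2 : R)^-1 * (Num.sqrt 2)^-1 = 2^-1.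
  by rewrite -invfM -expr2 sqr_sqrtr.
rewrite expr2 /omega; apply/eqP; rewrite eq_complex /= h.
by apply/andP; split; apply/eqP; lra.
Qed.

(** This is the conjugate of [omega]: seven T gates play the part of the inverse of T, which is not
    a gate. The measured gate rests on the identity H T^-1 X T H = S H S^-1 with S = T^2; for a = 0
    the same word without X collapses to the identity. *)
Lemma omega7 : omega ^+ 7 = (Complex (Num.sqrt 2)^-1 (- (Num.sqrt 2)^-1)).
Proof.
rewrite (_ : 7 = 2 + 2 + 2 + 1)%N // !exprD omega2 expr1 -expr2 sqr_i /omega.
by rewrite mulN1r; apply/eqP; rewrite eq_complex /=; apply/andP; split; apply/eqP; ring.
Qed.

(* The entry (z, t) of (H T^7) X^a (T H T^2) = S H^a. *)
Lemma measured_gate_amplitude a z t :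
  \sum_(s : bool) had1 z (a (+) s) * phase (a (+) s) ^+ 7 *
      (phase s * had1 s t * phase t ^+ 2) =
  phase z ^+ 2 * (if a then had1 z t else (z == t)%:R).
Proof.
have h : ((Num.sqrt 2 : R)^-1)%:C%C * ((Num.sqrt 2)^-1)%:C%C = 2^-1 :> (R[i])%C.
  rewrite -rmorphM /= -invfM -expr2 sqr_sqrtr // rmorphV ?rmorph_nat //.
  by rewrite unitfE pnatr_eq0.
have ii : 'i%C * 'i%C = -1 :> (R[i])%C by rewrite -expr2 sqr_i.
have w1 : omega = ((Num.sqrt 2 : R)^-1)%:C%C * (1 + 'i%C).
  by apply/eqP; rewrite eq_complex /=; apply/andP; split; apply/eqP; ring.
have w7 : omega ^+ 7 = ((Num.sqrt 2 : R)^-1)%:C%C * (1 - 'i%C).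
  by rewrite omega7; apply/eqP; rewrite eq_complex /=; apply/andP; split; apply/eqP; ring.
rewrite big_bool /had1 /phase.
(* Abstracting the constants turns the eight cases into polynomial identities in i and h with i * i
   = -1 and h * h = 1/2. [ring] closes five of them; the other three are first factored so that 2 *
   (h * h) = 1 can be rewritten. *)
move: w7 w1 omega2 h ii; move: omega ('i%C) (_%:C%C) => w i h w7 w1 w2 hh ii.
case: a; case: z; case: t; rewrite /= ?expr0 ?expr1 ?expr1n ?w7 ?w2 ?w1.
all: rewrite ?mulr1n ?mulr0n.
all: have e2 : 2 * 2^-1 = 1 :> (R[i])%C by rewrite mulfV ?pnatr_eq0.
all: move: hh e2; move: (2^-1) => e hh e2.
all: try by ring: hh ii e2.
- transitivity (- i * h * (2 * (h * h))); first by ring: ii.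
  by rewrite hh e2; ring.
- transitivity (h * h - 2 * (h * h) * (h * h)); first by ring: ii.
  by rewrite hh e2; ring.
- transitivity (i * (h * h - 2 * (h * h) * (h * h))); first by ring: ii.
  by rewrite hh e2; ring.
Qed.

End MeasuredGate.

Section MeasuredBlocks.
Variable R : realType.
Implicit Types (K : sop R) (env : nat -> sop R).

Lemma conjcX (x : (R[i])%C) k : (x ^+ k)^* = x^* ^+ k.
Proof. exact: rmorphXn. Qed.

Lemma conjc_sum (I : finType) (F : I -> (R[i])%C) : (\sum_i F i)^* = \sum_i (F i)^*.
Proof. exact: rmorph_sum. Qed.

(** The leftover S contributes a factor of modulus one that depends only on z; after z is measured,
    the factors of the amplitude and of its conjugate cancel. *)
Lemma phase2_norm z : phase R z ^+ 2 * (phase R z ^+ 2)^* = 1.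
Proof.
case: z; rewrite /phase ?expr1n ?omega2.
  by apply/eqP; rewrite eq_complex /=; apply/andP; split; apply/eqP; ring.
by rewrite mul1r rmorph1.
Qed.

Lemma sem_Seq_sends env c1 c2 y y' x x' v v' :
  sends (sem env c1) (cout c1) x x' v v' ->
  sem env (Seq c1 c2) y y' x x' = sem env c2 y y' v v'.
Proof. exact: seq_sends. Qed.

Lemma sem_Seq_receives env c1 c2 y y' x x' v v' :
  receives (sem env c2) (cout c1) y y' v v' ->
  sem env (Seq c1 c2) y y' x x' = sem env c1 v v' x x'.
Proof. exact: seq_receives. Qed.

Lemma sem_swap_measure env z b z' b' c s c' s' :
  sem env (Seq (Swap 1 1) (Par Measure Measure)) [:: z; b] [:: z'; b'] [:: c; s] [:: c'; s'] =
  [&& z == z', b == b', c == c', s == s', z == s & b == c]%:R.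
Proof.
have S := @sends_Swap R env 1 1 [:: c] [:: s] [:: c'] [:: s'] erefl erefl erefl erefl.
rewrite [LHS](seq_sends _ _ _ S) /= /par_sop /= mulr_bool !eqseq_cons !andbT.
by case: (z == z'); case: (b == b'); case: (c == c'); case: (s == s'); case: (z == s).
Qed.

Lemma sem_Seq_T_l env c y y' t t' :
  sem env (Seq GateT c) y y' [:: t] [:: t'] =
  sem env c y y' [:: t] [:: t'] * (phase R t * (phase R t')^*).
Proof. exact: seq_T_l. Qed.

Lemma sem_Seq_T_r env z z' x x' :
  sem env (Seq GateH GateT) [:: z] [:: z'] x x' =
  sem env GateH [:: z] [:: z'] x x' * (phase R z * (phase R z')^*).
Proof. exact: seq_T_r. Qed.

Lemma sem_H env z z' t t' :
  sem env GateH [:: z] [:: z'] [:: t] [:: t'] = had1 R z t * (had1 R z' t')^*.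
Proof. by rewrite /= /unitary_sop !hadamard1. Qed.

Lemma sem_Seq_Wires1_Par env c1 c2 y y' c c' s s' : cout c1 = 1 ->
  sem env (Seq (Par (Wires 1) c1) c2) y y' [:: c; s] [:: c'; s'] =
  \sum_(v : bool) \sum_(v' : bool)
    sem env c2 y y' [:: c; v] [:: c'; v'] * sem env c1 [:: v] [:: v'] [:: s] [:: s'].
Proof.
move=> o1; have -> : sem env (Seq (Par (Wires 1) c1) c2) =
    seq_sop (1 + 1) (par_sop 1 1 (@id_sop R) (sem env c1)) (sem env c2) by rewrite /= o1.
rewrite (@seq_Wires_par _ 1 1 1 _ _ _ _ [:: c] [:: c'] [:: s] [:: s']) //.
rewrite sum_tuple1 !sum_tuple1 !big_bool /=.
by rewrite addrC; congr (_ + _); rewrite addrC.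
Qed.

(** The final measurements force z = z' and b = b', and, since the CNOT keeps its control, also a =
    a' = b. What is left is an amplitude times the conjugate of an amplitude. *)
Lemma sem_measured_gate env z z' b b' a a' t t' :
  sem env measured_gate [:: z; b] [:: z'; b'] [:: a; t] [:: a'; t'] =
  [&& z == z', b == b', a == a' & b == a]%:R *
  (hadamard R [:: a] [:: z] [:: t] * (hadamard R [:: a] [:: z] [:: t'])^*).
Proof.
(* The matrix entries of T H T^2 and of H T^7, the unitaries before and after the CNOT. *)
pose pre s t := phase R s * had1 R s t * phase R t ^+ 2.
pose post z s := had1 R z s * phase R s ^+ 7.
set tail := Seq (Swap 1 1) (Par Measure Measure).
set gpost := Seq GateT (Seq GateT (Seq GateT (Seq GateT
  (Seq GateT (Seq GateT (Seq GateT GateH)))))).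
set gpre := Seq GateT (Seq GateT (Seq GateH GateT)).
have preE s s' u u' : sem env gpre [:: s] [:: s'] [:: u] [:: u'] = pre s u * (pre s' u')^*.
  by rewrite !sem_Seq_T_l sem_Seq_T_r sem_H /pre !conjcM !conjcX; ring.
have postE s s' u u' : sem env gpost [:: s] [:: s'] [:: u] [:: u'] = post s u * (post s' u')^*.
  by rewrite !sem_Seq_T_l sem_H /post !conjcM !conjcX; ring.
have tailE c s c' s' :
    sem env (Seq (Par (Wires 1) gpost) tail) [:: z; b] [:: z'; b'] [:: c; s] [:: c'; s'] =
    [&& z == z', b == b', c == c' & b == c]%:R * (post z s * (post z s')^*).
  rewrite sem_Seq_Wires1_Par // !big_bool !sem_swap_measure !postE.
  by case: z z' b b' c c' => [] [] [] [] [] [];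
    rewrite /= ?(mulr1n, mulr0n, mul0r, mul1r, addr0, add0r).
rewrite [LHS]sem_Seq_Wires1_Par //.
have cnotE v v' : sem env (Seq GateCNOT (Seq (Par (Wires 1) gpost) tail))
      [:: z; b] [:: z'; b'] [:: a; v] [:: a'; v'] =
    [&& z == z', b == b', a == a' & b == a]%:R * (post z (a (+) v) * (post z (a' (+) v'))^*).
  have S : sends (sem env GateCNOT) 2 [:: a; v] [:: a'; v'] [:: a; a (+) v] [:: a'; a' (+) v'].
    by split=> // y y' _ _; rewrite /= /unitary_sop conjc_bool.
  by rewrite (sem_Seq_sends _ _ _ S) tailE.
set B := [&& _, _, _ & _] in cnotE *.
(* The sum over the pair of intermediate states separates into a sum and a conjugated sum, each of
   the form of [measured_gate_amplitude]. *)
transitivity (B%:R * ((\sum_(v : bool) post z (a (+) v) * pre v t) *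
    (\sum_(v : bool) post z (a' (+) v) * pre v t')^*)).
  rewrite mulr_suml mulr_sumr; apply: eq_bigr => v _.
  rewrite conjc_sum !mulr_sumr; apply: eq_bigr => v' _.
  by rewrite cnotE preE !conjcM; ring.
rewrite /B !measured_gate_amplitude !hadamard1.
have [<-|] := eqVneq a a'; last by rewrite !andbF !mul0r.
by rewrite conjcM mulrACA phase2_norm mul1r.
Qed.

End MeasuredBlocks.

(** * Measuring blocks of qubits in the bases given by a bit string *)

Section MeasuredBlocks.
Variable R : realType.
Implicit Types (K : sop R) (env : nat -> sop R).

Lemma hadamard_cat th1 th2 z1 z2 u1 u2 :
  size z1 = size th1 -> size u1 = size th1 ->
  hadamard R (th1 ++ th2) (z1 ++ z2) (u1 ++ u2) = hadamard R th1 z1 u1 * hadamard R th2 z2 u2.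
Proof.
move=> sz su; pose f (th z u : bits) i : (R[i])%C :=
  let a := nth false z i in let b := nth false u i in
  if nth false th i then ((Num.sqrt 2)^-1)%:C%C * (-1) ^+ (a && b) else (a == b)%:R.
rewrite /hadamard -!(big_mkord xpredT (f _ _ _)) size_cat.
rewrite (big_cat_nat (n := size th1)) //=; last exact: leq_addr.
congr (_ * _); first by apply: eq_big_nat => i /andP[_ ilt]; rewrite /f !nth_cat sz su ilt.
rewrite -{1}[size th1]add0n big_addn addKn; apply: eq_bigr => i _.
by rewrite /f !nth_cat sz su !ltnNge !leq_addl /= !addnK.
Qed.

Lemma hadamard_nil z u : hadamard R [::] z u = 1.
Proof. by rewrite /hadamard big_ord0. Qed.

Lemma sem_Seq_Par_Wires env a b c c1 c2 y y' x1 x1' x2 x2' :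
  cin c1 = a -> cout c1 = b ->
  size x1 = a -> size x1' = a -> size x2 = c -> size x2' = c ->
  sem env (Seq (Par c1 (Wires c)) c2) y y' (x1 ++ x2) (x1' ++ x2') =
  \sum_(u : b.-tuple bool) \sum_(u' : b.-tuple bool)
    sem env c2 y y' (u ++ x2) (u' ++ x2') * sem env c1 u u' x1 x1'.
Proof. by move=> <- <- s1 s1' s2 s2'; exact: seq_par_Wires. Qed.

Lemma sem_Par_cat env c1 c2 y1 y1' y2 y2' x1 x1' x2 x2' :
  size y1 = cout c1 -> size y1' = cout c1 -> size x1 = cin c1 -> size x1' = cin c1 ->
  sem env (Par c1 c2) (y1 ++ y2) (y1' ++ y2') (x1 ++ x2) (x1' ++ x2') =
  sem env c1 y1 y1' x1 x1' * sem env c2 y2 y2' x2 x2'.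
Proof. exact: par_sop_cat. Qed.

Lemma sem_WiresE env n y y' x x' :
  sem env (Wires n) y y' x x' = (y == x)%:R * (y' == x')%:R.
Proof. by rewrite /= /id_sop /unitary_sop conjc_bool. Qed.

Lemma sem_measured_block env j a a' b b' z z' t t' :
  size z = j -> size z' = j -> size t = j -> size t' = j ->
  sem env (measured_block j) (z ++ [:: b]) (z' ++ [:: b']) (a :: t) (a' :: t') =
  [&& z == z', b == b', a == a' & b == a]%:R *
    (hadamard R (nseq j a) z t * (hadamard R (nseq j a) z t')^*).
Proof.
elim: j a a' z z' t t' => [|j IH] a a' z z' t t'.
  move=> /size0nil-> /size0nil-> /size0nil-> /size0nil->.
  rewrite hadamard_nil mul1r rmorph1 mulr1 /=.
  by case: a a' b b' => [] [] [] [].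
case: z z' => [//|z0 z] [//|z0' z']; case: t t' => [//|t0 t] [//|t0' t'] [sz] [sz'] [st] [st'].
rewrite -[z0 :: z]cat1s -[t0 :: t]cat1s -[z0' :: z']cat1s -[t0' :: t']cat1s.
rewrite -[nseq _ _]/([:: a] ++ nseq j a) !hadamard_cat //.
have := @sem_Seq_Par_Wires env 2 2 j measured_gate (Par (Wires 1) (measured_block j))
  (z0 :: z ++ [:: b]) (z0' :: z' ++ [:: b']) [:: a; t0] [:: a'; t0'] t t'
  erefl erefl erefl erefl st st'.
rewrite -[Seq _ _]/(measured_block j.+1) => E; rewrite [LHS]E {E}.
(* The basis bit handed on to the remaining qubits is the summed u1. All surviving terms have u1 =
   b, so the value is written with b and no longer depends on the summation variables. *)
pose G := [&& z == z' & b == b']%:R * (hadamard R (nseq j b) z t * (hadamard R (nseq j b) z t')^*)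
  * sem env measured_gate [:: z0; b] [:: z0'; b'] [:: a; t0] [:: a'; t0'].
rewrite (@sum_tuple_delta2 _ 2 [:: z0; b] [:: z0'; b'] _ (fun _ _ => G)) // => [|u u'].
  rewrite /G sem_measured_gate conjcM eqseq_cons.
  have [<-|ab] := eqVneq b a; last by rewrite !andbF /= !(mul0r, mulr0).
  move: (hadamard R [:: b] _ _) (hadamard R [:: b] _ _) => p p'.
  move: (hadamard R (nseq j b) _ _) (hadamard R (nseq j b) _ _) => q q'.
  rewrite mulrACA mulr_bool [X in _ = _ * X]mulrACA (mulrC (p' * _)).
  by congr (_%:R * _); case: (z == z'); case: (b == b'); case: (z0 == z0'); case: (b == a').
case/tupleP: u => u0 u; case/tupleP: u => u1 u; rewrite (tuple0 u) {u}.
case/tupleP: u' => u0' u'; case/tupleP: u' => u1' u'; rewrite (tuple0 u') {u'}.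
have -> : sem env (Par (Wires 1) (measured_block j)) (z0 :: z ++ [:: b]) (z0' :: z' ++ [:: b'])
    ([tuple u0; u1] ++ t) ([tuple u0'; u1'] ++ t') =
   (z0 == u0)%:R * (z0' == u0')%:R *
   sem env (measured_block j) (z ++ [:: b]) (z' ++ [:: b']) (u1 :: t) (u1' :: t').
  have := @sem_Par_cat env (Wires 1) (measured_block j) [:: z0] [:: z0']
    (z ++ [:: b]) (z' ++ [:: b']) [:: u0] [:: u0'] (u1 :: t) (u1' :: t') erefl erefl erefl erefl.
  by rewrite sem_WiresE !eqseq_cons !andbT.
rewrite IH // /G !eqseq_cons !andbT [tval _]/= [tval [tuple u0'; _]]/=.
have Z := (mul0r, mulr0, andbF).
have [<-|_] := eqVneq z0 u0; last by rewrite !Z.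
have [<-|_] := eqVneq z0' u0'; last by rewrite !Z.
have [<-|_] := eqVneq b u1; last by rewrite !Z.
have [<-|_] := eqVneq b b'; last by rewrite !Z.
have [<-|_] := eqVneq b u1'; last by rewrite !Z.
by rewrite !mul1r.
Qed.

Lemma sends_Par env c1 c2 x1 x1' x2 x2' v1 v1' v2 v2' :
  size x1 = cin c1 -> size x1' = cin c1 ->
  sends (sem env c1) (cout c1) x1 x1' v1 v1' -> sends (sem env c2) (cout c2) x2 x2' v2 v2' ->
  sends (sem env (Par c1 c2)) (cout (Par c1 c2))
    (x1 ++ x2) (x1' ++ x2') (v1 ++ v2) (v1' ++ v2').
Proof. exact: sends_par. Qed.

Lemma receives_Par env c1 c2 y1 y1' y2 y2' v1 v1' v2 v2' :
  size y1 = cout c1 -> size y1' = cout c1 ->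
  receives (sem env c1) (cin c1) y1 y1' v1 v1' -> receives (sem env c2) (cin c2) y2 y2' v2 v2' ->
  receives (sem env (Par c1 c2)) (cin (Par c1 c2))
    (y1 ++ y2) (y1' ++ y2') (v1 ++ v2) (v1' ++ v2').
Proof. exact: receives_par. Qed.

(** [commit_bases] freed from the security parameter; the two are convertible, which lets the
    circuit be matched with [rr_prover]. *)
Definition spread (n : nat) (a : bits) : bits := flatten [seq nseq n b | b <- a].

(** The outer two layers only route wires: the input is followed forwards through [P1], the output
    backwards through [P3], and the layer [P2] between them is a tensor product of one block and the
    remaining ones. *)
Lemma sem_measured_blocks env n j a a' b b' z z' t t' :
  size a = j -> size a' = j -> size b = j -> size b' = j ->
  size z = (j * n)%N -> size z' = (j * n)%N -> size t = (j * n)%N -> size t' = (j * n)%N ->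
  sem env (measured_blocks n j) (b ++ z) (b' ++ z') (a ++ t) (a' ++ t') =
  [&& z == z', b == b', a == a' & b == a]%:R *
    (hadamard R (spread n a) z t * (hadamard R (spread n a) z t')^*).
Proof.
elim: j a a' b b' z z' t t' => [|j IH] a a' b b' z z' t t'.
  do 4! move=> /size0nil->; rewrite !mul0n; do 4! move=> /size0nil->.
  have c1 : (1 : (R[i])%C)^* = 1 by exact: rmorph1.
  by rewrite hadamard_nil mul1r c1 mulr1 [measured_blocks n 0]/= sem_WiresE mulr1.
case: a a' b b' => [//|a0 a] [//|a0' a'] [//|b0 b] [//|b0' b'] [sa] [sa'] [sb] [sb'].
have split (u : bits) : size u = (j.+1 * n)%N -> exists u0 u1,
    [/\ u = u0 ++ u1, size u0 = n & size u1 = (j * n)%N].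
  by rewrite mulSn; exact: cat2_split.
move=> /split[z0 [z1 [-> sz0 sz1]]] /split[z0' [z1' [-> sz0' sz1']]].
move=> /split[t0 [t1 [-> st0 st1]]] /split[t0' [t1' [-> st0' st1']]].
have spreadE : spread n (a0 :: a) = nseq n a0 ++ spread n a by [].
rewrite spreadE !hadamard_cat ?size_nseq // {spreadE}.
set P1 := Par (Wires 1) (Par (Swap j n) (Wires (j * n))).
set P2 := Par (measured_block n) (measured_blocks n j).
set P3 := Par (Swap n j.+1) (Wires (j * n)).
have S : sends (sem env P1) (cout P1)
    ([:: a0] ++ (a ++ t0) ++ t1) ([:: a0'] ++ (a' ++ t0') ++ t1')
    ([:: a0] ++ (t0 ++ a) ++ t1) ([:: a0'] ++ (t0' ++ a') ++ t1').
  apply: sends_Par => //; first exact: sends_Wires.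
  apply: sends_Par; rewrite ?size_cat ?sa ?sa' ?st0 ?st0' //; last exact: sends_Wires.
  exact: sends_Swap.
have [_ i1 o1] := circuit_measured_block no_box n.
have [_ i2 o2] := circuit_measured_blocks no_box n j.
have oP2 : cout P2 = cin P3 by rewrite [cout P2]/= o1 o2 [cin P3]/= addnA addSnnS.
have Q : receives (sem env P3) (cin P3)
    (((b0 :: b) ++ z0) ++ z1) (((b0' :: b') ++ z0') ++ z1')
    ((z0 ++ (b0 :: b)) ++ z1) ((z0' ++ (b0' :: b')) ++ z1').
  apply: receives_Par; last exact: receives_Wires.
  - by rewrite size_cat /= sb sz0 addnC.
  - by rewrite size_cat /= sb' sz0' addnC.
  by apply: receives_Swap; rewrite /= ?sb ?sb'.
have -> : measured_blocks n j.+1 = Seq P1 (Seq P2 P3) by [].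
have catx (u0 : bool) u v w : (u0 :: u) ++ v ++ w = [:: u0] ++ (u ++ v) ++ w by rewrite /= -catA.
rewrite [(b0 :: b) ++ _]catA [(b0' :: b') ++ _]catA (catx a0) (catx a0').
rewrite -oP2 in Q; rewrite (sem_Seq_sends _ _ _ S) (sem_Seq_receives _ _ Q).
have caty (u0 : bool) u v w : (v ++ u0 :: u) ++ w = (v ++ [:: u0]) ++ (u ++ w).
  by rewrite -!catA.
have catz (u0 : bool) u v w : [:: u0] ++ (v ++ u) ++ w = (u0 :: v) ++ (u ++ w).
  by rewrite /= -catA.
rewrite (caty b0) (caty b0') (catz a0) (catz a0') sem_Par_cat;
  rewrite ?i1 ?o1 ?size_cat /= ?st0 ?st0' ?sz0 ?sz0' ?addn1 //.
rewrite sem_measured_block // IH // mulrACA mulr_bool !conjcM.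
rewrite [in RHS](mulrACA (hadamard R _ z0 t0)).
congr (_%:R * _); rewrite !eqseq_cat ?sz0 // !eqseq_cons.
by case: (z0 == z0'); case: (z1 == z1'); case: (b0 == b0'); case: (b == b');
  case: (a0 == a0'); case: (a == a'); case: (b0 == a0).
Qed.

End MeasuredBlocks.

(** * The prover's circuit around a classical oracle *)

Section CommitSemantics.
Variable R : realType.
Implicit Types (K : sop R) (env : nat -> sop R).

Lemma sem_layer_Measure env k y y' x x' :
  size y = k -> size y' = k -> size x = k -> size x' = k ->
  sem env (layer Measure k) y y' x x' = [&& y == y', x == x' & y == x]%:R.
Proof.
elim: k y y' x x' => [|k IH] y y' x x'.
  by do 4! move=> /size0nil->; rewrite [layer _ _]/= sem_WiresE mulr1.
case: y y' x x' => [//|b y] [//|b' y'] [//|a x] [//|a' x'] [sy] [sy'] [sx] [sx'].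
have := @sem_Par_cat R env Measure (layer Measure k) [:: b] [:: b'] y y' [:: a] [:: a'] x x'
  erefl erefl erefl erefl.
rewrite IH // [sem env Measure _ _ _ _]/= mulr_bool !eqseq_cons !andbT => E.
rewrite [LHS]E; congr (_%:R).
by case: (b == b'); case: (a == a'); case: (b == a); case: (y == y'); case: (x == x').
Qed.

Lemma sem_layer_Discard env k x x' : size x = k -> size x' = k ->
  sem env (layer Discard k) [::] [::] x x' = (x == x')%:R.
Proof.
elim: k x x' => [|k IH] x x'.
  by do 2! move=> /size0nil->; rewrite [layer _ _]/= sem_WiresE mulr1.
case: x x' => [//|a x] [//|a' x'] [sx] [sx'].
have := @sem_Par_cat R env Discard (layer Discard k) [::] [::] [::] [::] [:: a] [:: a'] x x'
  erefl erefl erefl erefl.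
by rewrite IH // [sem env Discard _ _ _ _]/= mulr_bool !eqseq_cons !andbT.
Qed.

(** What an oracle amounts to once query and answer are measured: weights [p y c], which are
    transition probabilities when [K] is a channel. The real and the simulated transcripts enter the
    circuit only in this form. *)
Definition samples K (i o : nat) (p : bits -> bits -> (R[i])%C) : Prop :=
  forall y y' c c' : bits, size y = o -> size y' = o -> size c = i -> size c' = i ->
    K y y' c c' = ((y == y') && (c == c'))%:R * p y c.

Lemma samples_measured env i o c : cin c = i -> cout c = o ->
  samples (sem env (measured i o c)) i o (fun y x => sem env c y y x x).
Proof.
move=> ci co y y' x x' sy sy' sx sx'.
have [_ _ oL] : circuit no_box (i * 1) (i * 1) (layer Measure i).
  exact: (@circuit_layer _ 1 1).
have inner v v' : size v = i -> size v' = i ->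
    sem env (Seq c (layer Measure o)) y y' v v' = (y == y')%:R * sem env c y y v v'.
  move=> sv sv'; rewrite [sem _ _]/= co.
  have [<-|yy'] := eqVneq y y'.
    rewrite mul1r.
    apply: (@sum_tuple_delta2 _ _ y y _ (fun u u' => sem env c u u' v v')) => // u u'.
    rewrite sem_layer_Measure ?size_tuple // eqxx /= mulrA mulr_bool; congr (_%:R * _).
    by rewrite [y == _]eq_sym andbC; case: eqP => [->|//]; rewrite eq_sym.
  rewrite mul0r /seq_sop big1 // => u _; rewrite big1 // => u' _.
  by rewrite sem_layer_Measure ?size_tuple // (negPf yy') mul0r.
rewrite /measured [sem _ _]/= oL muln1.
have [<-|xx'] := eqVneq x x'; last first.
  rewrite andbF mul0r /seq_sop big1 // => u _; rewrite big1 // => u' _.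
  by rewrite sem_layer_Measure ?size_tuple // (negPf xx') andbF mulr0.
rewrite andbT.
apply: (@sum_tuple_delta2 _ _ x x _ (fun u u' => (y == y')%:R * sem env c y y u u')) => // u u'.
have := inner u u'; rewrite [sem _ _]/= => ->; rewrite ?size_tuple //.
rewrite sem_layer_Measure ?size_tuple // eqxx /= mulrC mulrA mulr_bool; congr (_%:R * _).
by rewrite andbC; case: eqP => [->|//]; rewrite eq_sym.
Qed.

(** The reply of the round-reduced protocol omits the challenge, so the one in the transcript is
    traced out. The sum over v is genuine: a simulated transcript may contain another challenge than
    the one queried. *)
Lemma sem_Seq_discard env l1 m l2 B p a1 a1' a2 a2' c c' :
  cout B = (l1 + m + l2)%N -> samples (sem env B) m (l1 + m + l2) p ->
  size a1 = l1 -> size a1' = l1 -> size a2 = l2 -> size a2' = l2 ->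
  size c = m -> size c' = m ->
  sem env (Seq B (Par (Wires l1) (Par (layer Discard m) (Wires l2))))
    (a1 ++ a2) (a1' ++ a2') c c' =
  [&& a1 == a1', a2 == a2' & c == c']%:R * \sum_(v : m.-tuple bool) p (a1 ++ v ++ a2) c.
Proof.
move=> oB BP s1 s1' s2 s2' sc sc'.
have [_ iD oD] : circuit no_box (m * 1) (m * 0) (layer Discard m).
  exact: (@circuit_layer _ 1 0).
rewrite muln0 in oD; rewrite muln1 in iD.
set DC := Par _ _.
have DCE (u v w : bits) : size u = l1 -> size v = m -> size w = l2 ->
    sem env DC (a1 ++ a2) (a1' ++ a2') (u ++ v ++ w) (u ++ v ++ w) =
    (u == a1)%:R * ((w == a2)%:R * ((a1 == a1') && (a2 == a2'))%:R).
  move=> su sv sw.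
  rewrite (@sem_Par_cat _ env (Wires l1)) // -[a2]cat0s -[a2']cat0s.
  rewrite (@sem_Par_cat _ env (layer Discard m)) ?oD ?iD //.
  rewrite !sem_WiresE sem_layer_Discard // eqxx mul1r !mulr_bool; congr (_%:R).
  have [->|_] := eqVneq u a1; have [->|_] := eqVneq w a2; rewrite ?andbF //=.
  by rewrite [a1' == _]eq_sym [a2' == _]eq_sym.
rewrite [sem _ _]/= -/DC oB /seq_sop.
transitivity (\sum_(u : (l1 + m + l2).-tuple bool)
    (c == c')%:R * (sem env DC (a1 ++ a2) (a1' ++ a2') u u * p u c)).
  apply: eq_bigr => u _; rewrite (bigD1 u) //= big1 ?addr0 => [|u' u'u].
    by rewrite BP ?size_tuple // eqxx /=; ring.
  rewrite BP ?size_tuple // (_ : (tval u == tval u') = false) ?mul0r ?mulr0 //.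
  by apply/negbTE; rewrite eq_sym (inj_eq val_inj).
rewrite -mulr_sumr (sum_tuple_cat _ _ (fun u => sem env DC (a1 ++ a2) (a1' ++ a2') u u * p u c)).
rewrite (sum_tuple_cat _ _ (fun u => \sum_(w : l2.-tuple bool)
  sem env DC (a1 ++ a2) (a1' ++ a2') (u ++ w) (u ++ w) * p (u ++ w) c)).
pose g : (R[i])%C := ((a1 == a1') && (a2 == a2'))%:R.
transitivity ((c == c')%:R * \sum_(u : l1.-tuple bool) (tval u == a1)%:R *
    \sum_(v : m.-tuple bool) g * p (u ++ v ++ a2) c).
  congr (_ * _); apply: eq_bigr => u _; rewrite mulr_sumr; apply: eq_bigr => v _.
  rewrite -(sum_tuple_delta (fun w => (tval u == a1)%:R * (g * p (u ++ v ++ w) c)) s2).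
  by apply: eq_bigr => w _; rewrite -catA DCE ?size_tuple // /g; ring.
rewrite (sum_tuple_delta (fun u => \sum_(v : m.-tuple bool) g * p (u ++ v ++ a2) c) s1).
rewrite -mulr_sumr mulrA mulr_bool; congr (_%:R * _).
by case: (c == c'); case: (a1 == a1'); case: (a2 == a2').
Qed.

(** The oracle acts on C and the measurement on P, linked only by the classical string a1. Hence the
    entry is the weight of the transcript times the amplitudes of the outcome z in the bases that a1
    determines. *)
Lemma sem_commit_circ env l1 m l2 n B p a1 a1' a2 a2' z z' t t' c c' :
  cin B = m -> cout B = (l1 + m + l2)%N -> samples (sem env B) m (l1 + m + l2) p ->
  size a1 = l1 -> size a1' = l1 -> size a2 = l2 -> size a2' = l2 ->
  size z = (l1 * n)%N -> size z' = (l1 * n)%N ->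
  size t = (l1 * n)%N -> size t' = (l1 * n)%N -> size c = m -> size c' = m ->
  sem env (commit_circ l1 m l2 n B) (a1 ++ a2 ++ z) (a1' ++ a2' ++ z') (t ++ c) (t' ++ c') =
  [&& a1 == a1', a2 == a2', z == z' & c == c']%:R *
  ((\sum_(v : m.-tuple bool) p (a1 ++ v ++ a2) c) *
    (hadamard R (spread n a1) z t * (hadamard R (spread n a1) z t')^*)).
Proof.
move=> iB oB BP s1 s1' s2 s2' sz sz' st st' sc sc'.
have [_ iD oD] : circuit no_box (m * 1) (m * 0) (layer Discard m).
  exact: (@circuit_layer _ 1 0).
rewrite muln0 in oD; rewrite muln1 in iD.
have [_ iM oM] := circuit_measured_blocks no_box n l1.
rewrite /commit_circ; set lp := (l1 * n)%N in iM oM sz sz' st st' *.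
set BD := Seq B _; set C1 := Par (Wires l1) (Swap l2 lp).
set C2 := Par (measured_blocks n l1) (Wires l2); set C3 := Par (Wires l1) (Swap lp l2).
rewrite (sem_Seq_sends _ _ _ (sends_Swap env st st' sc sc')).
have oBD : cout BD = (l1 + l2)%N by rewrite /= oD.
rewrite (@sem_Seq_Par_Wires _ env m (l1 + l2)) //.
have tailE (b1 b1' b2 b2' : bits) :
    size b1 = l1 -> size b1' = l1 -> size b2 = l2 -> size b2' = l2 ->
    sem env (Seq C1 (Seq C2 C3)) (a1 ++ a2 ++ z) (a1' ++ a2' ++ z')
      ((b1 ++ b2) ++ t) ((b1' ++ b2') ++ t') =
    sem env (measured_blocks n l1) (a1 ++ z) (a1' ++ z') (b1 ++ t) (b1' ++ t') *
    ((a2 == b2)%:R * (a2' == b2')%:R).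
  move=> r1 r1' r2 r2'.
  have S : sends (sem env C1) (cout C1) (b1 ++ b2 ++ t) (b1' ++ b2' ++ t')
      (b1 ++ t ++ b2) (b1' ++ t' ++ b2').
    by apply: sends_Par => //; [exact: sends_Wires | exact: sends_Swap].
  have Q : receives (sem env C3) (cin C3) (a1 ++ a2 ++ z) (a1' ++ a2' ++ z')
      (a1 ++ z ++ a2) (a1' ++ z' ++ a2').
    by apply: receives_Par => //; [exact: receives_Wires | exact: receives_Swap].
  have oC2 : cin C3 = cout C2 by rewrite [cin C3]/= [cout C2]/= oM addnA.
  rewrite oC2 in Q; rewrite -!catA (sem_Seq_sends _ _ _ S) (sem_Seq_receives _ _ Q).
  rewrite !catA (@sem_Par_cat _ env) ?iM ?oM ?size_cat ?s1 ?s1' ?sz ?sz' ?r1 ?r1' ?st ?st' //.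
  by rewrite sem_WiresE.
pose h := hadamard R (spread n a1) z t * (hadamard R (spread n a1) z t')^*.
rewrite (@sum_tuple_delta2 _ _ (a1 ++ a2) (a1' ++ a2') _
  (fun _ _ => ((z == z') && (a1 == a1'))%:R * h *
     sem env BD (a1 ++ a2) (a1' ++ a2') c c')) => [|||u u'].
- rewrite (sem_Seq_discard oB BP) // -/h; move: (\sum_(v : m.-tuple bool) p (a1 ++ v ++ a2) c) => S.
  by case: (z == z'); case: (a1 == a1'); case: (a2 == a2'); case: (c == c');
    rewrite /= !(mul0r, mulr0, mul1r) // mulrC.
- by rewrite size_cat s1 s2.
- by rewrite size_cat s1' s2'.
have [u1 [u2 [-> r1 r2]]] := cat2_split (size_tuple u).
have [u1' [u2' [-> r1' r2']]] := cat2_split (size_tuple u').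
rewrite tailE // sem_measured_blocks // !eqseq_cat ?r1 ?r1' //.
have Z := (mul0r, mulr0, andbF, andFb).
have [<-|_] := eqVneq a1 u1; last by rewrite !Z.
have [<-|_] := eqVneq a2 u2; last by rewrite !Z.
have [<-|_] := eqVneq a2' u2'; last by rewrite !Z.
rewrite -/h; have [<-|ne] := eqVneq a1' u1'; last first.
  have [E|_] := eqVneq a1 a1'; last by rewrite !Z.
  by rewrite E (negPf ne) !Z.
by case: (z == z'); case: (a1 == a1'); rewrite /= !(mul0r, mulr0, mul1r, mulr1).
Qed.

End CommitSemantics.

(** * Simulation *)

Section Simulation.
Variables (R : realType) (Pi : sigma_protocol R) (n : nat -> nat).
Implicit Types (x w : bits) (B : circ) (env : nat -> sop R).

Local Notation l1 x := (sp_l1 Pi (size x)).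
Local Notation l2 x := (sp_l2 Pi (size x)).
Local Notation cl x := (sp_m Pi (size x)).
Local Notation tl x := (transcript_length Pi (size x)).
Local Notation lv x := (qp_lv (RR Pi n) (size x)).
Local Notation lr x := (qp_lr (RR Pi n) (size x)).

Definition rr_circ x B : circ := commit_circ (l1 x) (cl x) (l2 x) (n (size x)) B.

Lemma circuit_rr sig x B : circuit sig (cl x) (tl x) B -> circuit sig (lv x) (lr x) (rr_circ x B).
Proof. exact: circuit_commit. Qed.

(** By [sem_commit_circ] the circuit depends on [B] only through its weights. This exchanges an
    oracle box for the measured circuit of the honest-verifier simulator. *)
Lemma eq_rr_circ env env' x B B' p :
  cin B = cl x -> cout B = tl x -> cin B' = cl x -> cout B' = tl x ->
  samples (sem env B) (cl x) (tl x) p -> samples (sem env' B') (cl x) (tl x) p ->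
  eq_sop (lv x) (lr x) (sem env (rr_circ x B)) (sem env' (rr_circ x B')).
Proof.
move=> iB oB iB' oB' BP BP' y y' u u'.
move=> /cat3_split[a1 [a2 [z [-> s1 s2 sz]]]] /cat3_split[a1' [a2' [z' [-> s1' s2' sz']]]].
move=> /cat2_split[t [c [-> st sc]]] /cat2_split[t' [c' [-> st' sc']]].
by rewrite (sem_commit_circ iB oB BP) // (sem_commit_circ iB' oB' BP').
Qed.

Lemma samples_classical_oracle (K : sop R) i o :
  samples (classical_oracle K) i o (fun y c : bits => K y y c c).
Proof.
move=> y y' c c' _ _ _ _; rewrite /classical_oracle.
by case: ifP => _; rewrite ?mul1r ?mul0r.
Qed.

(** A real transcript repeats the challenge that was asked, so the sum over the discarded challenge
    has the single term v = c, whose weight is that of the honest prover. *)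
Lemma sem_rr_real env x w B :
  cin B = cl x -> cout B = tl x -> sem env B = real_transcript Pi x w ->
  eq_sop (lv x) (lr x) (sem env (rr_circ x B)) (qp_prover (RR Pi n) x w).
Proof.
move=> iB oB BE.
pose p (y c : bits) : (R[i])%C := (take (cl x) (drop (l1 x) y) == c)%:R *
  (sp_P1 Pi x w (take (l1 x) y) *
   sp_P2 Pi x w (take (l1 x) y) c (drop (l1 x + cl x) y))%:C%C.
have BP : samples (sem env B) (cl x) (tl x) p.
  move=> y y' c c' _ _ _ _; rewrite BE /real_transcript /p.
  by case: (y == y'); case: (c == c'); case: (_ == c); rewrite /= ?(mul0r, mul1r).
move=> y y' u u'.
move=> /cat3_split[a1 [a2 [z [-> s1 s2 sz]]]] /cat3_split[a1' [a2' [z' [-> s1' s2' sz']]]].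
move=> /cat2_split[t [c [-> st sc]]] /cat2_split[t' [c' [-> st' sc']]].
rewrite (sem_commit_circ iB oB BP) //.
have -> : \sum_(v : (cl x).-tuple bool) p (a1 ++ v ++ a2) c =
    (sp_P1 Pi x w a1 * sp_P2 Pi x w a1 c a2)%:C%C.
  rewrite -(sum_tuple_delta (fun=> (sp_P1 Pi x w a1 * sp_P2 Pi x w a1 c a2)%:C%C) sc).
  apply: eq_bigr => v _; rewrite /p take_size_cat // drop_size_cat // take_size_cat ?size_tuple //.
  by rewrite catA drop_size_cat // size_cat size_tuple s1.
have E1 : drop (l1 x + l2 x) (a1 ++ a2 ++ z) = z.
  by rewrite catA drop_size_cat // size_cat s1 s2.
rewrite [RHS]/= /rr_prover E1 (take_size_cat _ s1) (drop_size_cat _ s1) (take_size_cat _ s2).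
rewrite !(drop_size_cat _ st) (drop_size_cat _ st') (take_size_cat _ st) (take_size_cat _ st').
rewrite !eqseq_cat ?s1 ?s1' ?s2 ?s2' // -!andbA.
by case: ifP => _; rewrite ?mul1r ?mul0r.
Qed.

Lemma eq_sop_refl a b (K : sop R) : eq_sop a b K K. Proof. by []. Qed.

Lemma sem_sandwich env b c p A B C :
  cin B = b -> cout B = c -> cout A = (b + p)%N ->
  sem env (sandwich A B p C) =
  seq_sop (b + p) (sem env A) (seq_sop (c + p) (par_sop b c (sem env B) (@id_sop R)) (sem env C)).
Proof. by move=> <- <- E; rewrite /= E. Qed.

Lemma eq_run e r K K' D rho : eq_sop e e K K' ->
  Pr1 (e + r) (seq_sop (e + r) (par_sop e e K (@id_sop R)) D) rho =
  Pr1 (e + r) (seq_sop (e + r) (par_sop e e K' (@id_sop R)) D) rho.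
Proof.
move=> E; apply: eq_Pr1; apply: (eq_seq_sop (a := e + r) (c := 1)); last exact: eq_sop_refl.
exact: (eq_par_sop E (@eq_sop_refl r r _)).
Qed.

(** * From a channel distinguisher to an oracle distinguisher *)

Section Hybrid.
Variables (x : bits) (e p r : nat) (V1 V2 D : sop R) (cV1 cV2 cD : circ)
  (sig : signature) (env : sop R -> nat -> sop R).
Hypothesis cV1P : circuit sig e (lv x + p) cV1.
Hypothesis cV2P : circuit sig (lr x + p) e cV2.
Hypothesis cDP : circuit sig (e + r) 1 cD.
Hypothesis sem_cV1 : forall O, sem (env O) cV1 = V1.
Hypothesis sem_cV2 : forall O, sem (env O) cV2 = V2.
Hypothesis sem_cD : forall O, sem (env O) cD = D.
Hypothesis env0 : forall O, env O 0 = O.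

(** The oracle distinguisher against special qHVZK: the verifier runs around a prover whose
    transcript comes from box 0, then the channel distinguisher runs. Its components are circuits
    over any signature, so they can be explicit circuits or single boxes. *)
Definition hybrid_circ : circ :=
  Seq (Par (sandwich cV1 (rr_circ x (Box 0 (cl x) (tl x))) p cV2) (Wires r)) cD.

Lemma circuit_hybrid : sig 0 = Some (cl x, tl x) -> circuit sig (e + r) 1 hybrid_circ.
Proof.
move=> s0; apply: (circuit_Seq _ cDP); apply: (circuit_Par _ (circuit_Wires _ _)).
by apply: (circuit_sandwich cV1P _ cV2P); apply: circuit_rr; exact: circuit_Box.
Qed.

Lemma sem_hybrid O K rho :
  eq_sop (lv x) (lr x) (sem (env O) (rr_circ x (Box 0 (cl x) (tl x)))) K ->
  Pr1 (e + r) (sem (env O) hybrid_circ) rho =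
  Pr1 (e + r) (seq_sop (e + r) (par_sop e e
    (seq_sop (lv x + p) V1 (seq_sop (lr x + p) (par_sop (lv x) (lr x) K (@id_sop R)) V2))
    (@id_sop R)) D) rho.
Proof.
move=> E; set B := rr_circ x _ in E *.
have BP : circuit (one_box (cl x) (tl x)) (lv x) (lr x) B.
  by apply: circuit_rr; exact: circuit_Box.
have [_ iB oB] := BP; have [_ iA oA] := cV1P; have [_ _ oC] := cV2P.
pose X := sandwich cV1 B p cV2.
have -> : sem (env O) hybrid_circ = seq_sop (e + r) (par_sop e e (sem (env O) X) (@id_sop R)) D.
  have iX : cin X = e by []; have oX : cout X = e by [].
  transitivity (seq_sop (cout X + r)
    (par_sop (cin X) (cout X) (sem (env O) X) (@id_sop R)) (sem (env O) cD)) => //.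
  by rewrite sem_cD iX oX.
apply: eq_run; rewrite (@sem_sandwich _ _ _ _ _ _ _ iB oB oA) sem_cV1 sem_cV2.
apply: (eq_seq_sop (b := lv x + p)); first exact: eq_sop_refl.
apply: (eq_seq_sop (b := lr x + p)); last exact: eq_sop_refl.
exact: (eq_par_sop E (@eq_sop_refl p p _)).
Qed.

(** The reduction loses nothing: one circuit gives both channels, according to the oracle plugged
    in. The simulator has an environment of its own, because its boxes need not be numbered as in
    the hybrid, where box 0 is the oracle. *)
Lemma hybrid_advantage w S (sigS : signature) (envS : nat -> sop R) cA cC rho :
  circuit no_box (cl x) (tl x) S ->
  circuit sigS e (lv x + p) cA -> circuit sigS (lr x + p) e cC ->
  sem envS cA = V1 -> sem envS cC = V2 ->
  channel_advantage e r D (interaction (RR Pi n) x w p V1 V2)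
    (sem envS (sandwich cA (rr_circ x (measured (cl x) (tl x) S)) p cC)) rho =
  `|Pr1 (e + r) (sem (env (classical_oracle (sem (no_env R) S))) hybrid_circ) rho -
    Pr1 (e + r) (sem (env (real_transcript Pi x w)) hybrid_circ) rho|.
Proof.
move=> SP AP CP semA semC; have [Swf iS oS] := SP; have [_ _ oA] := AP.
have MP := circuit_measured SP; have [_ iM oM] := MP; have [_ iB oB] := circuit_rr MP.
rewrite (sem_hybrid (O := real_transcript Pi x w) (K := qp_prover (RR Pi n) x w)); last first.
  by apply: sem_rr_real => //; exact: env0.
rewrite (sem_hybrid (K := sem envS (rr_circ x (measured (cl x) (tl x) S)))); last first.
  apply: eq_rr_circ => //; last exact: samples_measured.
  rewrite (sem_no_box _ envS Swf) [sem (env _) _]env0.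
  exact: samples_classical_oracle.
by rewrite /channel_advantage (@sem_sandwich _ _ _ _ _ _ _ iB oB oA) semA semC distrC.
Qed.

End Hybrid.

Section Families.
Variables (I : Type) (inp : I -> tree) (sz : I -> nat) (xs : I -> bits).
Hypothesis inp_bounded : poly_bounded sz (tsize \o inp).
Hypothesis xsP : polytime inp sz (fun i => enc_bits (xs i)).
Hypothesis lengths : [/\ polytime_length (sp_l1 Pi), polytime_length (sp_m Pi) &
  polytime_length (sp_l2 Pi)].
Hypothesis nP : polytime_length n.
Local Notation PN f := (polytime inp sz (fun i => enc_nat (f i))).
Local Notation PC F := (polytime inp sz (fun i => desc (F i))).

Let sizeP := polytime_size inp_bounded xsP.

(** The presentation of x is left open: the computational simulator reads x alone, the statistical
    one also the sizes of the verifier's registers. *)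
Lemma polytime_lengths : [/\ PN (fun i => cl (xs i)), PN (fun i => tl (xs i)),
  PN (fun i => lv (xs i)) & PN (fun i => lr (xs i))].
Proof.
have [l1P clP l2P] := lengths.
have L l : polytime_length l -> PN (fun i => l (size (xs i))).
  by move=> lP; exact: (polytime_nat_comp lP sizeP).
have DP := polytimeD inp_bounded.
have MP := polytimeM inp_bounded (L _ l1P) (L _ nP).
split; first exact: L.
- exact: (DP _ _ (DP _ _ (L _ l1P) (L _ clP)) (L _ l2P)).
- exact: (DP _ _ MP (L _ clP)).
exact: (DP _ _ (DP _ _ (L _ l1P) (L _ l2P)) MP).
Qed.

Lemma polytime_rr_circ (B : I -> circ) : PC B -> PC (fun i => rr_circ (xs i) (B i)).
Proof.
have [l1P clP l2P] := lengths.
have L l : polytime_length l -> PN (fun i => l (size (xs i))).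
  by move=> lP; exact: (polytime_nat_comp lP sizeP).
by move=> BP; apply: polytime_commit_circ => //; exact: L.
Qed.

End Families.

Hypothesis lengths : [/\ polytime_length (sp_l1 Pi), polytime_length (sp_m Pi) &
  polytime_length (sp_l2 Pi)].
Hypothesis nP : polytime_length n.

(** Wire counts are in unary, so the size of a distinguisher bounds the reference register that it
    receives. *)
Lemma leq_cin_csize c : (cin c <= csize c)%N.
Proof. by rewrite /csize /desc /= tsize_enc_nat; lia. Qed.

Lemma enc_bits_bounded : poly_bounded size (tsize \o enc_bits).
Proof.
apply: (poly_bounded_leq (g := fun x => (4 * size x).+1)) => [x|].
  by apply: leq_trans (tsize_enc_bits x) _; lia.
by apply: poly_boundedS; exact: poly_boundedM (poly_bounded_const _ _) (poly_bounded_sz _).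
Qed.

Lemma computational_zk_RR : special_qHVZK Computational Pi -> computational_zk (RR Pi n).
Proof.
move=> [S [SP Sc Sadv]] e p V1 V2 V1P V2P V1c V2c.
have eb := enc_bits_bounded; have idP := polytime_id eb.
have [clP tlP lvP lrP] := polytime_lengths eb idP lengths nP.
(* The width of the private register is known only through the verifier's circuit: it is the number
   of output wires of [V1 x] minus the length of the message. *)
have pP : polytime enc_bits size (fun x => enc_nat (p x)).
  apply: polytime_ext (polytimeB eb (polytime_cout V1P) lvP) => x.
  by have [_ _ /= ->] := V1c x; rewrite addKn.
have MP := polytime_rr_circ eb idP lengths nP (polytime_measured eb clP tlP SP).
have BP := polytime_rr_circ eb idP lengths nP (polytime_Box 0 clP tlP).
exists (fun x => sandwich (V1 x) (rr_circ x (measured (cl x) (tl x) (S x))) (p x) (V2 x)).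
split.
- exact: polytime_sandwich.
- move=> x; apply: circuit_sandwich (V1c x) _ (V2c x).
  by apply: circuit_rr; apply: circuit_measured.
move=> d.
(* The negligible bound may depend on the exponent only, so d' is fixed before x, r and the
   distinguisher D. The factor 100 pays for D, the two compositions and the r idle wires, where r is
   bounded by the size of D. *)
have [d' d'P] : exists d', forall x r D,
    (e x + r = cin D)%N -> (csize D <= polybound d (size x))%N ->
    (csize (hybrid_circ x (p x) r (V1 x) (V2 x) D) <= polybound d' (size x))%N.
  have hb := polytime_bounded (polytime_sandwich eb V1P BP pP V2P).
  have [d' d'P] := poly_boundedD hb (poly_boundedM (poly_bounded_const size 100)
    (poly_boundedS (poly_bounded_polybound d (poly_bounded_sz size)))).
  exists d' => x r D De Db; apply: leq_trans (d'P x).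
  set X := sandwich (V1 x) (rr_circ x (Box 0 (cl x) (tl x))) (p x) (V2 x).
  change (csize (Seq (Par X (Wires r)) D) <=
    csize X + 100 * (polybound d (size x)).+1)%N.
  have := csize_Seq (Par X (Wires r)) D; have := csize_Par X (Wires r).
  have := csize_Wires r; have := leq_cin_csize D; lia.
have [eps epsN epsP] := Sadv d'; exists eps => // x w xw r rho D rhoP [cD [cDP cDs DE]].
have [wV1 iV1 _] := V1c x; have [wV2 _ _] := V2c x; have [wD iD _] := cDP.
pose env (O : sop R) j := if j is 0 then O else no_env R j.
have I O c : wf no_box c -> sem (env O) c = sem (no_env R) c by exact: sem_no_box.
have semD O : sem (env O) cD = D by rewrite DE I.
rewrite (hybrid_advantage r (V1c x) (V2c x) (fun O => I O _ wV1) (fun O => I O _ wV2) semD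
  (fun=> erefl) w rho (Sc x) (V1c x) (V2c x)) //.
apply: (epsP x w xw _ rho (fun O => sem (env O) (hybrid_circ x (p x) r (V1 x) (V2 x) cD)) rhoP).
exists (hybrid_circ x (p x) r (V1 x) (V2 x) cD); split=> //.
  by apply: (circuit_hybrid (e := e x)) => //; exact: circuit_no_box.
by apply: d'P; rewrite ?iD.
Qed.

Lemma statistical_zk_RR : special_qHVZK Statistical Pi -> statistical_zk (RR Pi n).
Proof.
move=> [S [SP Sc Sadv]] e p V1 V2 _ V1c V2c.
pose inp (x : bits) := Node (enc_bits x) (Node (enc_nat (e x)) (enc_nat (p x))).
pose sz (x : bits) := (size x + e x + p x)%N.
have sb : poly_bounded sz size.
  by apply: poly_bounded_leq (poly_bounded_sz sz) => x; rewrite /sz; lia.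
have ib : poly_bounded sz (tsize \o inp).
  apply: (poly_bounded_leq (g := fun x => (10 * (sz x).+1)%N)) => [x|].
    by have := tsize_enc_bits x; rewrite /= !tsize_enc_nat /sz; lia.
  exact: poly_boundedM (poly_bounded_const _ _) (poly_boundedS (poly_bounded_sz _)).
have inpP := polytime_id ib.
have xP : polytime inp sz enc_bits by exact: (polytime_thead inpP).
have eP : polytime inp sz (fun x => enc_nat (e x)).
  exact: (polytime_thead (polytime_ttail inpP)).
have pP : polytime inp sz (fun x => enc_nat (p x)).
  exact: (polytime_ttail (polytime_ttail inpP)).
have [clP tlP lvP lrP] := polytime_lengths ib xP lengths nP.
have SP' : polytime inp sz (fun x => desc (S x)).
  exact: (polytime_comp (h := id) xP sb SP).
have MP := polytime_rr_circ ib xP lengths nP (polytime_measured ib clP tlP SP').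
pose cV1 x := Box 0 (e x) (lv x + p x); pose cV2 x := Box 1 (lr x + p x) (e x).
exists (fun x => sandwich (cV1 x) (rr_circ x (measured (cl x) (tl x) (S x))) (p x) (cV2 x)).
split.
- apply: polytime_sandwich => //.
    by apply: polytime_Box => //; exact: polytimeD.
  by apply: polytime_Box => //; exact: polytimeD.
- move=> x; apply: (@circuit_sandwich _ _ (lv x) (lr x));
    [exact: circuit_Box | | exact: circuit_Box].
  by apply: circuit_rr; apply: circuit_measured; exact: circuit_no_box.
move=> d.
(* Exponent 1 is enough: only oracle queries are counted here, and the hybrid makes a single one. *)
have [eps epsN epsP] := Sadv 1; exists eps => // x w xw r rho D rhoP DP.
(* Box 0 becomes the oracle, so the verifier's two operations, boxes 0 and 1 for the simulator, move
   to 1 and 2, and the unbounded channel distinguisher is box 3. *)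
pose sig j := match j with
  | 0 => Some (cl x, tl x) | 1 => Some (e x, lv x + p x)%N
  | 2 => Some (lr x + p x, e x)%N | 3 => Some (e x + r, 1)%N | _ => None end.
pose env0 j := match j with 1 => V1 x | 2 => V2 x | _ => D end.
pose env (O : sop R) j := if j is 0 then O else env0 j.
pose hV1 := Box 1 (e x) (lv x + p x); pose hV2 := Box 2 (lr x + p x) (e x).
pose hD := Box 3 (e x + r) 1.
have hV1P : circuit sig (e x) (lv x + p x) hV1 by exact: circuit_Box.
have hV2P : circuit sig (lr x + p x) (e x) hV2 by exact: circuit_Box.
have hDP : circuit sig (e x + r) 1 hD by exact: circuit_Box.
have cV1P : circuit (two_boxes (e x) (lv x + p x) (lr x + p x) (e x)) (e x) (lv x + p x) (cV1 x).
  exact: circuit_Box.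
have cV2P : circuit (two_boxes (e x) (lv x + p x) (lr x + p x) (e x)) (lr x + p x) (e x) (cV2 x).
  exact: circuit_Box.
rewrite (@hybrid_advantage _ _ _ r _ _ D _ _ hD _ env hV1P hV2P _ _ _ _ w _ _ _ _ _ rho
  (Sc x) cV1P cV2P) //.
apply: (epsP x w xw _ rho (fun O => sem (env O) (hybrid_circ x (p x) r hV1 hV2 hD)) rhoP).
exists (hybrid_circ x (p x) r hV1 hV2 hD), sig, env0.
split=> //.
- exact: circuit_hybrid.
- have -> : calls 0 (hybrid_circ x (p x) r hV1 hV2 hD) =
      calls 0 (rr_circ x (Box 0 (cl x) (tl x))) by rewrite /= !addn0.
  by rewrite calls_commit /polybound addn1.
by move=> [|[|[|[|j]]]] a b //= _ [] // <- <-; [exact: V1c | exact: V2c | exact: DP].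
Qed.

End Simulation.

Theorem theorem7 (R : realType) (L : bits -> Prop) (Pi : sigma_protocol R)
    (n : nat -> nat) (k : zk_type) :
  sigma_protocol_for Pi L ->
  polytime_length n ->
  special_qHVZK k Pi ->
  quantum_zk k (RR Pi n).
Proof.
move=> [_ lengths _ _ _] nP; case: k => /=.
  exact: computational_zk_RR.
exact: statistical_zk_RR.
Qed.
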